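(* Let $T_M>0$, $c>0$, and let $f$ be the solution of $$f''(y)-cf'(y)-f^4(y)=-\int_0^\infty E(y-\eta)f^4(\eta)d\eta\ (y>0),\qquad f(0)=T_M,\qquad f\ge0,$$ obtained by the iterative construction described in the context. Then the limit $f_\infty:=\lim_{y\to\infty}f(y)$ exists and $f_\infty>0$.
   Context: $E(x)=\frac12\int_{|x|}^\infty\frac{e^{-t}}{t}dt$. Iterative construction: $f_0=0$ and, for $n\ge0$, $f_{n+1}$ is the unique minimizer over $\{f\ge0: f\in W^{1,2}(e^{-cy}dy,\mathbb R_+)\cap L^5(e^{-cy}dy,\mathbb R_+),\ f(0)=T_M\}$ of $\int_0^\infty e^{-cy}\big(\frac{(f')^2}{2}+\frac{f^5}{5}+g_nf\big)dy$, $g_n(y)=-\int_0^\infty E(y-\eta)f_n^4(\eta)d\eta$ (so $f_{n+1}''-cf_{n+1}'-f_{n+1}^4=g_n$, $f_{n+1}(0)=T_M$); the sequence is increasing, bounded by $T_M$, and $f=\lim_nf_n$. *)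

(* Defs.v *)
From HB Require Import structures.
From mathcomp Require Import all_boot all_order all_algebra.
From mathcomp Require Import all_classical all_reals all_analysis.
Set Implicit Arguments. Unset Strict Implicit. Unset Printing Implicit Defensive.
Import Order.TTheory GRing.Theory Num.Theory.
Import numFieldNormedType.Exports.
Local Open Scope classical_set_scope.
Local Open Scope ring_scope.

Section Defs.
Variable R : realType.
Notation mu := (@lebesgue_measure R).

(* E(x) = 1/2 int_{|x|}^oo e^{-t}/t dt  (for x <> 0; the value at x = 0,
   where the integral is +oo, is irrelevant since it is a null set). *)
Definition Ekernel (x : R) : R :=
  2^-1 * fine (\int[mu]_(t in `[`|x|, +oo[) (expR (- t) / t)%:E).

Definition gsrc (fn : R -> R) (y : R) : R :=
  - fine (\int[mu]_(eta in `[0, +oo[) (Ekernel (y - eta) * fn eta ^+ 4)%:E).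

(* (f, g) is an admissible pair: f >= 0 on R_+, f(0) = TM, f is locally
   absolutely continuous on R_+ with (weak) derivative g, and
   f, g in L^2(e^{-cy}dy, R_+), f in L^5(e^{-cy}dy, R_+);
   i.e. f in W^{1,2}(e^{-cy}dy,R_+) cap L^5(e^{-cy}dy,R_+). *)
Definition admissible (c TM : R) (f g : R -> R) : Prop :=
  (forall y, 0 <= y -> 0 <= f y) /\
  f 0 = TM /\
  (forall y, 0 <= y -> mu.-integrable `[0, y] (fun t => (g t)%:E)) /\
  (forall y, 0 <= y -> f y = TM + Rintegral mu `[0, y] g) /\
  mu.-integrable `[0, +oo[ (fun y => (expR (- (c * y)) * g y ^+ 2)%:E) /\
  mu.-integrable `[0, +oo[ (fun y => (expR (- (c * y)) * f y ^+ 2)%:E) /\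
  mu.-integrable `[0, +oo[ (fun y => (expR (- (c * y)) * f y ^+ 5)%:E).

Definition energy (c : R) (gn : R -> R) (f g : R -> R) : \bar R :=
  \int[mu]_(y in `[0, +oo[)
     (expR (- (c * y)) * (g y ^+ 2 / 2 + f y ^+ 5 / 5 + gn y * f y))%:E.

Definition is_minimizer (c TM : R) (gn : R -> R) (f : R -> R) : Prop :=
  exists g, admissible c TM f g /\
    forall h gh, admissible c TM h gh -> (energy c gn f g <= energy c gn h gh)%E.

Definition iterates (c TM : R) (fs : nat -> R -> R) : Prop :=
  (forall y, fs 0%N y = 0) /\
  forall n, is_minimizer c TM (gsrc (fs n)) (fs n.+1).

End Defs.

(* Main.v *)
(** Write [u = f^4] and extend it by zero to the negative half-line.  Since the
    kernel has total mass 1, [u - E * u] is the derivative of [S * u], where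
    [S] is odd, decays exponentially and jumps by 1 at the origin.  The equation thus integrates once to
      f' = c (f - a) + S * u   for some constant [a].
    Multiply by [u - b], [b = max(0,a)^4], and integrate over [[0,Y]].  Oddness
    of [S] cancels the self-interaction of [[0,Y]], so what the convolution
    contributes is bounded uniformly in [Y]; hence [(f - a)(u - b) >= 0] is
    integrable and, [f] being Lipschitz, [f] tends to [max(0,a)].
    If [a <= 0] then [f -> 0], and the identity obtained with [b = 0] reads
      c \int u (f - a) = - T_M^5 / 5 < 0,
    which is impossible.

    The equation for [f] is the pointwise limit of the Euler-Lagrange equations
    of the minimizers.  One-sided variations along tent functions show that
    [f - c \int f - \int\int (f^4 + g_n)] is concave; this forces [f > 0], so
    two-sided variations are allowed and the expression is affine.  The bound
    [f <= T_M] holds because [e^{-cy} f'] is nondecreasing wherever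
    [f >= T_M], so that exceeding [T_M] would give growth like [e^{cy}]. *)

Require Import Defs.
From HB Require Import structures.
From mathcomp Require Import all_boot all_order all_algebra.
From mathcomp Require Import all_classical all_reals all_analysis.
From mathcomp Require Import measurable_realfun.
From mathcomp Require Import ring lra.
Import Order.TTheory GRing.Theory Num.Theory.
Import numFieldNormedType.Exports.
Local Open Scope classical_set_scope.
Local Open Scope ring_scope.
Set Implicit Arguments. Unset Strict Implicit. Unset Printing Implicit Defensive.

(** A minimizer comes only with a weak derivative, so the Euler-Lagrange equation is kept in twice
    integrated form. In that form pointwise convergence of the iterates and dominated convergence
    are enough for the passage to the limit.

    The kernel is singular at 0. It is treated as a mixture of boxes, E(x) = 1/2 \int k(t) 1_(|x| <=
    t) dt with k(t) = e^(-t)/t, so that its integrals reduce to lengths of interval overlaps, S to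
    the ramps (t - |z|)_+, and the primitive of S to their squares.

    The obstacle at infinity is that u = f^4 is not integrable when f has a positive limit, so size
    alone does not bound the integral of S * u over [0, Y]. The bound comes from the decay of the
    primitive of S: a source at eta is felt only through its distances to the two ends 0 and Y.

    The sign of a is not known in advance, and b is chosen to make f - a and u - b agree in sign in
    either case. When a <= 0, the contradiction is already reached on a finite interval [0, Z],
    beyond which f is small. *)

Section integrable_functions.
Context {R : realType}.
Notation mu := (@lebesgue_measure R).
Implicit Types (D : set R) (f g h : R -> R).

(** * Integrable real functions, parameter integrals and Fubini's theorem *)

Definition LI D f := mu.-integrable D (EFin \o f).

Lemma LI_measurable D f : LI D f -> measurable_fun D f.
Proof. by move=> /measurable_int /measurable_EFinP. Qed.

Lemma LI_eq D f g : measurable D -> (forall x, D x -> f x = g x) -> LI D f -> LI D g.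
Proof.
move=> mD fg; apply: eq_integrable => // x; rewrite inE => Dx.
by rewrite /= fg.
Qed.

Lemma LI_le D f g : measurable D -> measurable_fun D f ->
  (forall x, D x -> `|f x| <= g x) -> LI D g -> LI D f.
Proof.
move=> mD mf fg; apply: le_integrable => //; first exact/measurable_EFinP.
move=> x Dx /=; rewrite lee_fin (le_trans (fg x Dx))// ler_norm//.
Qed.

Lemma LI_subset D D' f : measurable D -> measurable D' -> D' `<=` D ->
  LI D f -> LI D' f.
Proof. by move=> mD mD' DD'; apply: integrableS. Qed.

Lemma LI_D D f g : measurable D -> LI D f -> LI D g ->
  LI D (fun x => f x + g x).
Proof. by move=> mD lf lg; exact: (@integrableD _ _ _ mu D _ _ _ lf lg). Qed.

Lemma LI_B D f g : measurable D -> LI D f -> LI D g ->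
  LI D (fun x => f x - g x).
Proof. by move=> mD lf lg; exact: (@integrableB _ _ _ mu D _ _ _ lf lg). Qed.

Lemma LI_Z D f k : measurable D -> LI D f -> LI D (fun x => k * f x).
Proof. by move=> mD lf; exact: (@integrableZl _ _ _ mu D _ k _ lf). Qed.

Lemma LI_norm D f : LI D f -> LI D (fun x => `|f x|).
Proof. exact: integrable_norm. Qed.

Lemma LI_cst D k : measurable D -> (mu D < +oo)%E -> LI D (fun=> k).
Proof. move=> mD fD; apply: measurable_bounded_integrable => //.
exists `|k|; split; rewrite ?num_real// => M kM x _ /=.
exact: ltW. Qed.

Lemma LI_bounded D f B : measurable D -> (mu D < +oo)%E ->
  measurable_fun D f -> (forall x, D x -> `|f x| <= B) -> LI D f.
Proof.
move=> mD fD mf fB.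
exact: (@LI_le D f (fun=> B) mD mf fB (LI_cst B mD fD)).
Qed.

Lemma LI_mul_bounded D f h B : measurable D -> measurable_fun D h ->
  (forall x, D x -> `|h x| <= B) -> LI D f -> LI D (fun x => h x * f x).
Proof.
move=> mD mh hB lf.
apply: (@LI_le _ _ (fun x => B * `|f x|)) => //.
- by apply: measurable_funM => //; exact: LI_measurable.
- by move=> x Dx; rewrite normrM ler_wpM2r// hB.
- by apply: LI_Z => //; exact: LI_norm.
Qed.

Lemma itvcc_lty (a b : R) : (mu `[a, b] < +oo)%E.
Proof.
by rewrite lebesgue_measure_itv/=; case: ifP => // _; rewrite -EFinD ltry.
Qed.

Lemma LI_itv_bounded (a b : R) f B : measurable_fun `[a, b] f ->
  (forall x, a <= x <= b -> `|f x| <= B) -> LI `[a, b] f.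
Proof.
by move=> mf fB; apply: (@LI_bounded _ _ B) => //; exact: itvcc_lty.
Qed.

Lemma Rint_bound (a b : R) f B : a <= b -> LI `[a, b] f ->
  (forall x, a <= x <= b -> `|f x| <= B) ->
  `|Rintegral mu `[a, b] f| <= B * (b - a).
Proof.
move=> ab lf fB; rewrite (le_trans (le_normr_Rintegral _ _))//.
have -> : B * (b - a) = Rintegral mu `[a, b] (fun=> B).
  rewrite Rintegral_cst//= lebesgue_measure_itv/= lte_fin; congr (_ * _).
  by case: ltP => //= ba; lra.
apply: le_Rintegral => //; first exact: LI_norm.
by apply: LI_cst => //; exact: itvcc_lty.
Qed.

Lemma Rint_cat (a b c : R) f : a <= b -> b <= c -> LI `[a, c] f ->
  Rintegral mu `[a, c] f = Rintegral mu `[a, b] f + Rintegral mu `[b, c] f.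
Proof.
move=> ab bc lf; rewrite -(@Rintegral_itv_obnd_cbnd _ b); last first.
  by apply: LI_subset lf => //; apply: subset_itvr; rewrite bnd_simp.
rewrite -(@Rintegral_itvB _ _ (BLeft a) (BRight c))// ?bnd_simp//.
by rewrite addrC subrK.
Qed.

(** The positive and negative parts are handled separately by Tonelli, so no integrability is
    assumed: measurability also covers the points where [Rintegral] takes a default value. *)
Lemma measurable_Rintegral_param (D : set R) (P : R -> R -> R) :
  measurable D -> measurable_fun setT (fun p : R * R => P p.1 p.2) ->
  measurable_fun setT (fun x => Rintegral mu D (P x)).
Proof.
move=> mD mP.
pose Q (p : R * R) := (P p.1 p.2 * \1_D p.2)%:E.
have mQ : measurable_fun setT Q.
  apply/measurable_EFinP; apply: measurable_funM; first exact: mP.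
  by apply: measurableT_comp => //; exact: measurable_indic.
have QE : (fun x => Rintegral mu D (P x)) =
    (fun x => fine (\int[mu]_y Q^\+ (x, y) - \int[mu]_y Q^\- (x, y))%E).
  apply/funext => x; rewrite /Rintegral integral_mkcond integralE.
  congr (fine (_ - _)%E); apply: eq_integral => y _.
    rewrite !funeposE /Q patchE indicE/=.
    by case: ifPn => yD; rewrite ?mulr1 ?mulr0.
  rewrite !funenegE /Q patchE indicE/=.
  by case: ifPn => yD; rewrite ?mulr1 ?mulr0.
rewrite QE; apply: (measurableT_comp (@fine_measurable R setT measurableT)).
apply: emeasurable_funB.
- apply: (@measurable_fun_fubini_tonelli_F _ _ _ _ _ mu (Q^\+)%E) => //.
  exact: measurable_funepos.
- apply: (@measurable_fun_fubini_tonelli_F _ _ _ _ _ mu (Q^\-)%E) => //.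
  exact: measurable_funeneg.
Qed.

(** Every slice, not just almost every one, is assumed integrable, so that [fine] loses nothing in
    either inner integral. Indicators of [D1] and [D2] move the problem to the whole plane. *)
Lemma Rintegral_swap (D1 D2 : set R) (P : R -> R -> R) :
  measurable D1 -> measurable D2 ->
  measurable_fun setT (fun p : R * R => P p.1 p.2) ->
  (forall x, D1 x -> LI D2 (P x)) -> (forall y, D2 y -> LI D1 (P^~ y)) ->
  LI D1 (fun x => Rintegral mu D2 (fun y => `|P x y|)) ->
  LI D1 (fun x => Rintegral mu D2 (P x)) /\
  Rintegral mu D1 (fun x => Rintegral mu D2 (P x)) =
  Rintegral mu D2 (fun y => Rintegral mu D1 (P^~ y)).
Proof.
move=> mD1 mD2 mP lPx lPy lN.
pose Q (p : R * R) := (P p.1 p.2 * \1_D1 p.1 * \1_D2 p.2)%:E.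
have mQ : measurable_fun setT Q.
  apply/measurable_EFinP; apply: measurable_funM; first apply: measurable_funM.
  - exact: mP.
  - by apply: measurableT_comp => //; exact: measurable_indic.
  - by apply: measurableT_comp => //; exact: measurable_indic.
have F1 x : (\int[mu]_y Q (x, y) = ((fun x => Rintegral mu D2 (P x)) \_ D1 x)%:E)%E.
  rewrite patchE; case: ifPn => [|xD].
  - rewrite inE => Dx; rewrite /Rintegral fineK; last first.
      by apply: integrable_fin_num => //; exact: lPx.
    rewrite [RHS]integral_mkcond; apply: eq_integral => y _.
    rewrite /Q /= patchE indicE mem_set//= mulr1 indicE.
    by case: ifPn => yD; rewrite ?mulr1 ?mulr0.
  - rewrite integral0_eq// => y _; rewrite /Q/= indicE (negbTE xD).
    by rewrite mulr0 mul0r.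
have F2 y : (\int[mu]_x Q (x, y) = ((fun y => Rintegral mu D1 (P^~ y)) \_ D2 y)%:E)%E.
  rewrite patchE; case: ifPn => [|yD].
  - rewrite inE => Dy; rewrite /Rintegral fineK; last first.
      by apply: integrable_fin_num => //; exact: lPy.
    rewrite [RHS]integral_mkcond; apply: eq_integral => x _.
    rewrite /Q /= patchE indicE [in \1_D2 _]indicE (@mem_set _ D2)//= mulr1.
    by case: ifPn => xD; rewrite ?mulr1 ?mulr0.
  - rewrite integral0_eq// => x _; rewrite /Q/= [in \1_D2 _]indicE (negbTE yD).
    by rewrite mulr0.
have iQ : (mu \x mu)%E.-integrable setT Q.
  apply/integrable12ltyP => //.
  rewrite (@le_lt_trans _ _ (\int[mu]_(x in D1)
      (Rintegral mu D2 (fun y => `|P x y|))%:E)%E)//; last exact: integrable_lty.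
  rewrite [leRHS]integral_mkcond; apply: ge0_le_integral => //.
  - by move=> x _; exact: integral_ge0.
  - apply: (@measurable_fun_fubini_tonelli_F _ _ _ _ _ mu (abse \o Q)) => //=.
    exact: measurableT_comp.
  - apply: (measurable_restrictT _ _).1 => //; apply/measurable_EFinP.
    exact: LI_measurable.
  - move=> x _; rewrite patchE; case: ifPn => [|xD]; last first.
      rewrite integral0_eq// => y _; rewrite /Q/= indicE (negbTE xD).
      by rewrite mulr0 mul0r normr0.
    rewrite inE => Dx; rewrite /Rintegral fineK; last first.
      by apply: integrable_fin_num => //; apply: LI_norm; exact: lPx.
    rewrite [leRHS]integral_mkcond; apply: ge0_le_integral => //.
    + apply: measurableT_comp => //.
      exact: (measurableT_comp mQ (measurable_pair1 x)).
    + apply: (measurable_restrictT _ _).1 => //; apply/measurable_EFinP.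
      by apply: LI_measurable; apply: LI_norm; exact: lPx.
    + move=> y _; rewrite /Q patchE/= indicE mem_set//= mulr1 indicE.
      case: ifPn => [|yD]; last by rewrite /= mulr0 normr0.
      by rewrite inE => Dy; rewrite /= mulr1 lee_fin.
split.
  have := integrable_fubini_F iQ; rewrite /fubini_F.
  under eq_fun do rewrite F1.
  move=> h; apply/(@integrable_mkcond _ _ _ mu) => //.
  by rewrite restrict_EFin.
have := Fubini iQ.
under eq_integral do rewrite F1.
under [X in _ = X -> _]eq_integral do rewrite F2.
move=> h; rewrite Rintegral_mkcond [RHS]Rintegral_mkcond.
exact: (congr1 fine h).
Qed.

Lemma Rintegral_fubini (D1 D2 : set R) (P : R -> R -> R) (a b : R -> R) :
  measurable D1 -> measurable D2 ->
  measurable_fun setT (fun p : R * R => P p.1 p.2) ->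
  LI D1 a -> LI D2 b ->
  (forall x y, D1 x -> D2 y -> `|P x y| <= a x * b y) ->
  LI D1 (fun x => Rintegral mu D2 (P x)) /\
  Rintegral mu D1 (fun x => Rintegral mu D2 (P x)) =
  Rintegral mu D2 (fun y => Rintegral mu D1 (P^~ y)).
Proof.
move=> mD1 mD2 mP la lb Pab.
have lPx x : D1 x -> LI D2 (P x).
  move=> Dx; apply: (@LI_le _ _ (fun y => a x * b y)) => //.
  - apply: measurable_funTS.
    exact: (measurableT_comp mP (measurable_pair1 x)).
  - by move=> y Dy; exact: Pab.
  - exact: LI_Z.
apply: Rintegral_swap => //.
  move=> y Dy; apply: (@LI_le _ _ (fun x => b y * a x)) => //.
  - apply: measurable_funTS.
    exact: (measurableT_comp mP (measurable_pair2 y)).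
  - by move=> x Dx; rewrite mulrC; exact: Pab.
  - exact: LI_Z.
apply: (@LI_le _ _ (fun x => Rintegral mu D2 b * a x)) => //.
- apply: measurable_funTS.
  apply: (@measurable_Rintegral_param D2 (fun x y => `|P x y|)) => //.
  exact: measurableT_comp.
- move=> x Dx; rewrite ger0_norm ?Rintegral_ge0// mulrC -RintegralZl//.
  apply: le_Rintegral => //.
  + by apply: LI_norm; exact: lPx.
  + exact: LI_Z.
  + by move=> y Dy; exact: Pab.
- exact: LI_Z.
Qed.

End integrable_functions.

(** * Locally absolutely continuous functions on the half-line *)

Section primitives.
Context {R : realType}.
Notation mu := (@lebesgue_measure R).
Implicit Types (F G f g h : R -> R) (a b e k s t x y z B Y : R).

(** Local absolute continuity of F on the half-line with density f, the only regularity that a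
    minimizer provides. Values at negative arguments are unconstrained, which is why continuity is
    later stated for nonnegative points only. *)
Definition prim F f := forall y, 0 <= y ->
  LI `[0, y] f /\ F y = F 0 + Rintegral mu `[0, y] f.

Lemma Rint_pt (a : R) f : Rintegral mu `[a, a] f = 0.
Proof. by rewrite set_itv1 Rintegral_set1. Qed.

Lemma prim_eq F f G g : prim F f -> (forall y, 0 <= y -> F y = G y) ->
  (forall y, 0 <= y -> f y = g y) -> prim G g.
Proof.
move=> pF FG fg y y0; have [lf Fy] := pF y y0; split.
  by apply: LI_eq lf => // x /=; rewrite in_itv/= => /andP[x0 _]; exact: fg.
rewrite -!FG// Fy; congr (_ + _); apply: eq_Rintegral => x; rewrite inE/=.
by rewrite in_itv/= => /andP[x0 _]; exact: fg.
Qed.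

Lemma prim_int k f : (forall y, 0 <= y -> LI `[0, y] f) ->
  prim (fun y => k + Rintegral mu `[0, y] f) f.
Proof. by move=> lf y y0; rewrite Rint_pt addr0; split => //; exact: lf. Qed.

Lemma prim_D F f G g : prim F f -> prim G g ->
  prim (fun y => F y + G y) (fun y => f y + g y).
Proof.
move=> pF pG y y0; have [lf Fy] := pF y y0; have [lg Gy] := pG y y0.
by split; [exact: LI_D|rewrite RintegralD// Fy Gy; ring].
Qed.

Lemma prim_Z F f k : prim F f -> prim (fun y => k * F y) (fun y => k * f y).
Proof.
move=> pF y y0; have [lf Fy] := pF y y0.
by split; [exact: LI_Z|rewrite RintegralZl// Fy; ring].
Qed.

Lemma prim_B F f G g : prim F f -> prim G g ->
  prim (fun y => F y - G y) (fun y => f y - g y).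
Proof.
move=> pF /(prim_Z (-1)) pG; apply: prim_eq (prim_D pF pG) _ _ => y _; ring.
Qed.

Lemma prim_cst k : prim (fun=> k) (fun=> 0).
Proof.
move=> y y0; split; first by apply: LI_cst => //; exact: itvcc_lty.
by rewrite Rintegral_cst// mul0r addr0.
Qed.

Lemma prim_LI F f a b : prim F f -> 0 <= a -> LI `[a, b] f.
Proof.
move=> pF a0; have [ab|ba] := leP a b.
  have [lf _] := pF b (le_trans a0 ab).
  by apply: LI_subset lf => //; apply: subset_itvr; rewrite bnd_simp.
rewrite set_itv_ge -?leNgt ?bnd_simp -?ltNge//.
exact: integrable_set0.
Qed.

Lemma prim_sub F f a b : prim F f -> 0 <= a -> a <= b ->
  F b - F a = Rintegral mu `[a, b] f.
Proof.
move=> pF a0 ab; have b0 := le_trans a0 ab.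
have [lf ->] := pF b b0; have [_ ->] := pF a a0.
by rewrite (Rint_cat a0 ab)//; ring.
Qed.

Lemma prim_nondecreasing F f a b : prim F f -> 0 <= a -> a <= b ->
  (forall x, a <= x <= b -> 0 <= f x) -> F a <= F b.
Proof.
move=> pF a0 ab f0; rewrite -subr_ge0 (prim_sub pF)//.
by apply: Rintegral_ge0 => x /=; rewrite in_itv/=; exact: f0.
Qed.

Lemma prim_le F f G g a b : prim F f -> prim G g -> 0 <= a -> a <= b ->
  (forall x, a <= x <= b -> f x <= g x) -> F b - F a <= G b - G a.
Proof.
move=> pF pG a0 ab fg.
have : G a - F a <= G b - F b.
  apply: (prim_nondecreasing (prim_B pG pF)) => // x xab.
  by rewrite subr_ge0 fg.
by lra.
Qed.

Lemma prim_bounded F f Y : prim F f -> 0 <= Y ->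
  exists2 B, 0 < B & forall y, 0 <= y <= Y -> `|F y| <= B.
Proof.
move=> pF Y0; exists (`|F 0| + Rintegral mu `[0, Y] (fun x => `|f x|) + 1).
  by rewrite ltr_pwDr// addr_ge0// Rintegral_ge0.
move=> y /andP[y0 yY]; have [lf ->] := pF y y0.
have [lfY _] := pF Y Y0.
rewrite (le_trans (ler_normD _ _))// -addrA lerD2l.
rewrite (le_trans (le_normr_Rintegral _ _))//.
rewrite (Rint_cat y0 yY); last exact: LI_norm.
rewrite -addrA lerDl addr_ge0// Rintegral_ge0// => x _.
Qed.

Lemma prim_within_continuous F f b : prim F f -> 0 <= b ->
  {within `[0, b], continuous F}.
Proof.
move=> pF b0; have [lf _] := pF b b0.
have c := parameterized_integral_continuous b0 lf.
have h : {in `[0, b]%classic, (fun y => F 0 + Rintegral mu `[0, y] f) =1 F}.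
  move=> x; rewrite inE/= in_itv/= => /andP[x0 _].
  by have [_ ->] := pF x x0.
apply: (@subspace_eq_continuous R `[0, b]%classic R _ F h).
by move=> x; apply: (@cvgD _ R^o); [exact: cvg_cst|exact: c].
Qed.

Lemma prim_cts F f y e : prim F f -> 0 <= y -> 0 < e ->
  exists2 d, 0 < d & forall z, 0 <= z -> `|z - y| < d -> `|F z - F y| < e.
Proof.
move=> pF y0 e0.
have y1 : 0 <= y + 1 by rewrite addr_ge0.
have /(_ y) := prim_within_continuous pF y1.
have yin : `[0, y + 1]%classic y by rewrite /= in_itv/= y0/= lerDl.
rewrite /prop_for /continuous_at => /cvgrPdist_lt /(_ e e0).
rewrite /nbhs/= -nbhs_subspace_in//.
rewrite /within/= => -[d /= d0 H].
exists (Num.min d 1); first by rewrite lt_min d0/=.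
move=> z z0; rewrite lt_min => /andP[zd z1].
rewrite distrC; apply: H; first by rewrite /= distrC.
rewrite /= in_itv/= z0/=.
by move: z1; rewrite ltr_norml => /andP[_]; rewrite ltrBlDl => /ltW.
Qed.

Lemma prim_measurable F f : prim F f -> measurable_fun (`[0, +oo[%classic : set R) F.
Proof.
move=> pF; rewrite itv_bndy_bigcup_BRight; apply/measurable_fun_bigcup => //.
move=> n; rewrite add0r.
apply: subspace_continuous_measurable_fun => //.
by apply: (prim_within_continuous pF).
Qed.

Lemma measurable_itvW (h : R -> R) (y : R) : measurable_fun (`[0, +oo[%classic : set R) h ->
  measurable_fun (`[0, y]%classic : set R) h.
Proof. by apply: measurable_funS => //; apply: subset_itvl. Qed.

Lemma prim_LI_int F f : prim F f -> forall y, 0 <= y -> LI `[0, y] F.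
Proof.
move=> pF y y0; have [B _ FB] := prim_bounded pF y0.
apply: (@LI_itv_bounded _ _ _ _ B); last exact: FB.
by apply: measurable_itvW; exact: (prim_measurable pF).
Qed.

Lemma Rint_if_le (s y : R) h : 0 <= s <= y ->
  Rintegral mu `[0, y] (fun t => if t <= s then h t else 0) =
  Rintegral mu `[0, s] h.
Proof.
move=> /andP[s0 sy]; rewrite [LHS]Rintegral_mkcond [RHS]Rintegral_mkcond.
apply: eq_Rintegral => t _; rewrite !patchE !mem_setE !in_itv/=.
by have [ts|ts] := leP t s; rewrite ?(le_trans ts sy)//= ?andbT ?andbF; case: ifP.
Qed.

Lemma Rint_if_ge (s y : R) h : 0 <= s <= y ->
  Rintegral mu `[0, y] (fun t => if s <= t then h t else 0) =
  Rintegral mu `[s, y] h.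
Proof.
move=> /andP[s0 sy]; rewrite [LHS]Rintegral_mkcond [RHS]Rintegral_mkcond.
apply: eq_Rintegral => t _; rewrite !patchE !mem_setE !in_itv/=.
by have [ts|ts] := leP s t; rewrite ?(le_trans s0 ts)//=; case: ifP.
Qed.

(** Product rule without derivatives: f(s) g(t) is integrated over the triangle t <= s <= y in both
    orders. One order gives \int f (G - G 0), the other \int (F y - F) g. *)
Lemma prim_mul F f G g : prim F f -> prim G g ->
  prim (fun y => F y * G y) (fun y => f y * G y + F y * g y).
Proof.
move=> pF pG y y0.
have [lf Fy] := pF y y0; have [lg Gy] := pG y y0.
have mF : measurable_fun `[0, y] F.
  by apply: measurable_itvW; exact: (prim_measurable pF).
have mG : measurable_fun `[0, y] G.
  by apply: measurable_itvW; exact: (prim_measurable pG).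
have [BF _ FB] := prim_bounded pF y0; have [BG _ GB] := prim_bounded pG y0.
have lfG : LI `[0, y] (fun x => f x * G x).
  apply: (@LI_eq _ _ (fun x => G x * f x)) => // [x _|]; first exact: mulrC.
  by apply: (@LI_mul_bounded _ _ _ _ BG) => // x /=; rewrite in_itv/=; exact: GB.
have lFg : LI `[0, y] (fun x => F x * g x).
  by apply: (@LI_mul_bounded _ _ _ _ BF) => // x /=; rewrite in_itv/=; exact: FB.
split; first exact: LI_D.
rewrite RintegralD//.
pose P s t := if t <= s then (f \_ `[0, y]) s * (g \_ `[0, y]) t else 0.
have mf' : measurable_fun setT (f \_ `[0, y]).
  by apply: (measurable_restrictT _ _).1 => //; exact: LI_measurable.
have mg' : measurable_fun setT (g \_ `[0, y]).
  by apply: (measurable_restrictT _ _).1 => //; exact: LI_measurable.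
have mP : measurable_fun setT (fun p : R * R => P p.1 p.2).
  apply: measurable_fun_ifT.
  - exact: measurable_fun_ler.
  - by apply: measurable_funM; apply: measurableT_comp.
  - exact: measurable_cst.
have PE s t : 0 <= s <= y -> 0 <= t <= y ->
    P s t = if t <= s then f s * g t else 0.
  by move=> sy ty; rewrite /P !patchE !mem_set.
have [] := @Rintegral_fubini _ `[0, y] `[0, y] P (fun s => `|f s|)
   (fun t => `|g t|) _ _ mP.
- by [].
- by [].
- exact: LI_norm.
- exact: LI_norm.
- move=> s t /=; rewrite !in_itv/= => sy ty; rewrite PE//.
  by case: ifP => _; rewrite ?normrM// normr0 mulr_ge0.
move=> _.
have -> : Rintegral mu `[0, y] (fun x => Rintegral mu `[0, y] (P x)) =
    Rintegral mu `[0, y] (fun x => f x * G x - G 0 * f x).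
  apply: eq_Rintegral => s; rewrite inE/= in_itv/= => sy.
  have [s0 sy'] := andP sy.
  transitivity (Rintegral mu `[0, y] (fun t => if t <= s then f s * g t else 0)).
    by apply: eq_Rintegral => t; rewrite inE/= in_itv/= => ty; exact: PE.
  have [lgs Gs] := pG s s0.
  rewrite Rint_if_le// RintegralZl// Gs; ring.
have -> : Rintegral mu `[0, y] (fun t => Rintegral mu `[0, y] (P^~ t)) =
    Rintegral mu `[0, y] (fun t => F y * g t - F t * g t).
  apply: eq_Rintegral => t; rewrite inE/= in_itv/= => ty.
  have [t0 ty'] := andP ty.
  transitivity (Rintegral mu `[0, y] (fun s => if t <= s then g t * f s else 0)).
    apply: eq_Rintegral => s; rewrite inE/= in_itv/= => sy.
    by rewrite PE// [f s * _]mulrC.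
  rewrite Rint_if_ge// RintegralZl//; last exact: prim_LI pF t0.
  rewrite -(prim_sub pF)//; ring.
rewrite !RintegralB ?RintegralZl//; try exact: LI_Z.
have -> : Rintegral mu `[0, y] f = F y - F 0 by rewrite Fy; ring.
by rewrite Gy; lra.
Qed.

Lemma prim_ramp s : prim (fun y => Num.max 0 (y - s)) (\1_`[s, +oo[).
Proof.
move=> y y0; split.
  apply: (@LI_itv_bounded _ _ _ _ 1); first exact: measurable_indic.
  by move=> x _; rewrite indicE; case: (_ \in _); rewrite ?normr1 ?normr0.
rewrite /Rintegral integral_indic//=.
have -> : `[s, +oo[%classic `&` `[0, y]%classic = `[Num.max 0 s, y]%classic :> set R.
  apply/seteqP; split => x /=; rewrite !in_itv/= andbT ge_max.
    by move=> [-> /andP[-> ->]].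
  by move=> /andP[/andP[-> ->] ->].
rewrite lebesgue_measure_itv/= lte_fin.
have [s0|s0] := leP 0 s; rewrite ?sub0r.
  have [|] := leP 0 (y - s) => h; have [|] := ltP s y => h' /=;
  have [|] := leP 0 (- s) => h'' /=; lra.
have [|] := leP 0 (y - s) => h; have [|] := ltP 0 y => h' /=;
  have [|] := leP 0 (- s) => h'' /=; lra.
Qed.

Lemma prim_derive F f : (forall x : R, is_derive x (1 : R) F (f x)) ->
  continuous f -> prim F f.
Proof.
move=> dF cf y; rewrite le_eqVlt => /predU1P[<-|y0].
  rewrite Rint_pt addr0; split => //.
  apply: (@LI_itv_bounded _ _ _ _ `|f 0|).
    by apply: measurable_funTS; exact: continuous_measurable_fun.
  by move=> x; rewrite -eq_le => /eqP <-.
have cF : continuous F.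
  by move=> x; apply: differentiable_continuous; apply/derivable1_diffP; apply: ex_derive.
split.
  apply: continuous_compact_integrable; first exact: segment_compact.
  exact: continuous_subspaceT.
rewrite /Rintegral (continuous_FTC2 y0 (continuous_subspaceT cf) (F := F)).
- by rewrite /=; lra.
- split; first by move=> x _; exact: ex_derive.
  + by apply: cvg_at_right_filter; exact: cF.
  + by apply: cvg_at_left_filter; exact: cF.
- by move=> x _; rewrite derive1E derive_val.
Qed.

Lemma prim_expR k : prim (fun y => expR (k * y)) (fun y => k * expR (k * y)).
Proof.
apply: prim_derive => x.
  have h : is_derive x 1 (fun y : R => k * y) k.
    by have := is_deriveZ k (is_derive_id x (1:R)); rewrite /GRing.scale/= mulr1.
  have := is_derive1_comp (is_derive_expR (k * x)) h.
  by rewrite mulrC.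
apply: cvgM; first exact: cvg_cst.
apply: (@cvg_comp _ _ _ (fun y => k * y)); last exact: continuous_expR.
by apply: cvgM; [exact: cvg_cst|exact: cvg_id].
Qed.

End primitives.

(** * Integrals of exponentials on the half-line *)

Section exponential_integrals.
Context {R : realType}.
Notation mu := (@lebesgue_measure R).
Implicit Types (f g h : R -> R) (a b k t x y z B Y : R).

Lemma measurable_expRM k (D : set R) :
  measurable_fun D (fun t : R => expR (k * t)).
Proof.
by apply: measurable_funTS; apply: measurableT_comp.
Qed.

Lemma measurable_expRN k (D : set R) :
  measurable_fun D (fun t : R => expR (- (k * t))).
Proof.
apply: measurable_funTS; apply: measurableT_comp => //.
exact: measurableT_comp.
Qed.

Lemma continuous_expRM k : continuous (fun t : R => expR (k * t)).
Proof.
move=> x; apply: (@cvg_comp _ _ _ (fun y => k * y)); last exact: continuous_expR.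
by apply: cvgM; [exact: cvg_cst|exact: cvg_id].
Qed.

Lemma integral_expRN k a : 0 < k ->
  (\int[mu]_(t in `[a, +oo[) (expR (- (k * t)))%:E = (expR (- (k * a)) / k)%:E)%E.
Proof.
move=> k0.
pose F t := - (expR (- (k * t)) / k).
have dF x : is_derive x 1 F (expR (- (k * x))).
  have h : is_derive x 1 (fun y : R => - k * y) (- k).
    by have := is_deriveZ (- k) (is_derive_id x (1:R)); rewrite /GRing.scale/= mulr1.
  have h2 := is_derive1_comp (is_derive_expR (- k * x)) h.
  have := is_deriveZ (- k^-1) h2; rewrite /GRing.scale/=.
  have -> : - k^-1 * (expR (- k * x) * - k) = expR (- (k * x)).
    by rewrite !mulNr mulrN mulrN opprK mulrCA mulVf ?mulr1// gt_eqF.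
  rewrite (_ : - k^-1 \*: _ = F)//; apply/funext => t.
  by rewrite /F/= /GRing.scale/= !mulNr mulrC.
rewrite (@ge0_continuous_FTC2y _ _ F a 0).
- by rewrite /F -EFinD; congr EFin; ring.
- by move=> x _; exact: expR_ge0.
- apply: continuous_subspaceT; under eq_fun do rewrite -mulNr.
  exact: continuous_expRM.
- rewrite /F -oppr0; apply: cvgN; rewrite -(mul0r k^-1).
  apply: cvgM; last exact: cvg_cst.
  apply: (@cvg_comp _ _ _ (fun t => k * t) (fun t => expR (- t)) _ +oo); last exact: cvgr_expR.
  by apply: (gt0_cvgMry (f := id)) => //; exact: cvg_id.
- by move=> x _; exact: ex_derive.
- apply: cvg_at_right_filter.
  by apply: differentiable_continuous; apply/derivable1_diffP; apply: ex_derive.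
- by move=> x _; rewrite derive1E derive_val.
Qed.

Lemma LI_expRN k a : 0 < k -> LI `[a, +oo[ (fun t => expR (- (k * t))).
Proof.
move=> k0; apply/integrableP; split.
  by apply/measurable_EFinP; exact: measurable_expRN.
under eq_integral => t _ do rewrite /= ger0_norm ?expR_ge0//.
by rewrite integral_expRN// ltry.
Qed.

Lemma Rint_expRN k a : 0 < k ->
  Rintegral mu `[a, +oo[ (fun t => expR (- (k * t))) = expR (- (k * a)) / k.
Proof. by move=> k0; rewrite /Rintegral integral_expRN. Qed.

Lemma Rint_half_line_split Y f : 0 <= Y -> LI `[0, +oo[ f ->
  Rintegral mu `[0, +oo[ f =
  Rintegral mu `[0, Y] f + Rintegral mu `]Y, +oo[ f.
Proof.
move=> Y0 lf; rewrite -(@Rintegral_itvB _ _ (BLeft 0) +oo%O Y)// ?bnd_simp//.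
by rewrite addrC subrK.
Qed.

Lemma LI_subset_half_line f a (b : itv_bound R) : 0 <= a -> LI `[0, +oo[ f ->
  LI [set` Interval (BLeft a) b] f.
Proof.
by move=> a0; apply: LI_subset => //; apply: subset_itv; rewrite ?bnd_simp.
Qed.

(** Keeps compactly supported perturbations of a minimizer inside the weighted spaces. *)
Lemma LI_half_line_patch (T : R) f g : 0 <= T -> LI `[0, +oo[ f -> LI `[0, T] g ->
  (forall y, T < y -> g y = f y) -> LI `[0, +oo[ g.
Proof.
move=> T0 lf lg fg.
have lf' : LI `]T, +oo[ g.
  apply: (@LI_eq _ _ f) => // [x|]; first by rewrite /= in_itv/= andbT => /fg.
  by apply: LI_subset lf => //; apply: subset_itvr; rewrite bnd_simp.
rewrite (_ : `[0, +oo[%classic = `[0, T]%classic `|` `]T, +oo[%classic); last first.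
  by rewrite (@itv_bndbnd_setU _ _ (BLeft 0) (BRight T) +oo%O)// bnd_simp.
move: lg lf' => /integrableP[mg ig] /integrableP[mg' ig'].
have mU : measurable_fun (`[0, T] `|` `]T, +oo[) (EFin \o g).
  exact/measurable_funU.
apply/integrableP; split => //.
rewrite ge0_integral_setU//=.
- exact: lte_add_pinfty.
- apply/measurable_EFinP; apply: measurableT_comp => //.
  exact/measurable_EFinP.
- apply/disj_setPS => x [/=]; rewrite !in_itv/= andbT => /andP[_ xT] Tx.
  by move: (lt_le_trans Tx xT); rewrite ltxx.
Qed.

Lemma LI_expRN_dist k Y : 0 < k -> 0 <= Y ->
  LI `[0, +oo[ (fun x => expR (- (k * `|Y - x|))).
Proof.
move=> k0 Y0.
apply: (@LI_le _ _ _ (fun x => expR (k * Y) * expR (- (k * x)))) => //.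
- apply: measurable_funTS; apply: measurableT_comp => //.
  apply: measurableT_comp => //; apply: measurable_funM => //.
  apply: measurableT_comp => //; exact: measurable_funB.
- move=> x /=; rewrite in_itv/= andbT => x0.
  rewrite ger0_norm ?expR_ge0// -expRD ler_expR.
  rewrite -mulrBr -mulrN ler_wpM2l ?(ltW k0)//.
  by rewrite lerNl -normrN ler_norm.
- by apply: LI_Z => //; exact: LI_expRN.
Qed.

Lemma Rint_expRN_dist k Y : 0 < k -> 0 <= Y ->
  Rintegral mu `[0, +oo[ (fun x => expR (- (k * `|Y - x|))) <= 2 / k.
Proof.
move=> k0 Y0; have l := LI_expRN_dist k0 Y0.
rewrite (Rint_half_line_split Y0 l).
have -> : Rintegral mu `]Y, +oo[ (fun x => expR (- (k * `|Y - x|))) = 1 / k.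
  transitivity (Rintegral mu `]Y, +oo[ (fun x => expR (k * Y) * expR (- (k * x)))).
    apply: eq_Rintegral => x; rewrite inE/= in_itv/= andbT => Yx.
    rewrite -expRD ltr0_norm ?subr_lt0//; congr expR; ring.
  rewrite Rintegral_itv_obnd_cbnd; last first.
    apply: LI_Z => //; apply: LI_subset (LI_expRN Y k0) => //.
    by apply: subset_itvr; rewrite bnd_simp.
  rewrite RintegralZl//; last exact: LI_expRN.
  by rewrite Rint_expRN// mulrA -expRD subrr expR0.
have -> : Rintegral mu `[0, Y] (fun x => expR (- (k * `|Y - x|))) =
    (1 - expR (- (k * Y))) / k.
  have p := prim_expR k.
  transitivity (Rintegral mu `[0, Y]
      (fun x => expR (- (k * Y)) / k * (k * expR (k * x)))).
    apply: eq_Rintegral => x; rewrite inE/= in_itv/= => /andP[x0 xY].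
    rewrite ger0_norm ?subr_ge0// mulrA mulfVK ?gt_eqF//.
    by rewrite -expRD; congr expR; ring.
  have [lp pY] := p Y Y0.
  rewrite RintegralZl//.
  have -> : Rintegral mu `[0, Y] (fun x => k * expR (k * x)) = expR (k * Y) - 1.
    by move: pY; rewrite mulr0 expR0; lra.
  rewrite mulrBr mulr1 mulrAC -expRD.
  by rewrite (_ : - (k * Y) + k * Y = 0) ?expR0; [ring|ring].
rewrite -mulrDl ler_wpM2r ?invr_ge0 ?ltW//.
have := expR_gt0 (- (k * Y)); lra.
Qed.

End exponential_integrals.

(** * The kernel E as a mixture of boxes, and its odd tail S *)

Section kernel.
Context {R : realType}.
Notation mu := (@lebesgue_measure R).
Implicit Types (t x y z : R).

Lemma measurable_invr : measurable_fun setT (@GRing.inv R).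
Proof.
have m1 : measurable [set 0 : R] by [].
have mC : measurable (~` [set 0 : R]) by exact: measurableC.
rewrite -(setvU [set 0 : R]); apply/(measurable_funU _ mC m1); split.
  apply: open_continuous_measurable_fun.
    by apply: closed_openC; apply: accessible_closed_set1;
      apply: hausdorff_accessible; exact: Rhausdorff.
  by move=> x; rewrite inE/= => /eqP x0; exact: inv_continuous.
exact: measurable_fun_set1.
Qed.

(** The mixing weight of the boxes. It is not integrable at 0, so it always comes with a factor of
    order t or a cutoff away from 0. Its value at 0 is 0, by the convention for division. *)
Definition kern t : R := expR (- t) / t.

(** The length of the part of the box [-t, t] lying beyond |z| on one side, with the sign of z. At z
    = 0 the right limit is taken, so oddness fails there. *)
Definition Sden t z : R :=
  if 0 <= z then Num.max 0 (t - z) else - Num.max 0 (t + z).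

(* S(z) = sgn(z) \int_|z|^oo E, written through the mixture of box kernels
   E(x) = 1/2 \int k(t) 1_(|x| <= t) dt. *)
Definition Sker z : R :=
  2^-1 * Rintegral mu `[0, +oo[ (fun t => kern t * Sden t z).

Lemma kern_ge0 t : 0 <= t -> 0 <= kern t.
Proof. by move=> t0; rewrite /kern divr_ge0// expR_ge0. Qed.

Lemma measurable_kern (D : set R) : measurable_fun D kern.
Proof.
apply: measurable_funTS; apply: measurable_funM.
  exact: measurableT_comp.
exact: measurable_invr.
Qed.

Lemma measurable_kern_snd : measurable_fun setT (fun p : R * R => kern p.2).
Proof.
have mk : measurable_fun setT kern by exact: measurable_kern.
exact: (measurableT_comp mk measurable_snd).
Qed.

Lemma kernMt t : 0 < t -> kern t * t = expR (- t).
Proof. by move=> t0; rewrite /kern mulfVK// gt_eqF. Qed.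

Lemma norm_Sden t z : 0 <= t -> `|Sden t z| = Num.max 0 (t - `|z|).
Proof.
move=> t0; rewrite /Sden; have [z0|z0] := leP 0 z.
  by rewrite (ger0_norm z0) ger0_norm// le_max lexx.
by rewrite normrN (ltr0_norm z0) opprK ger0_norm// le_max lexx.
Qed.

Lemma kern_Sden_bound t z : 0 <= t ->
  `|kern t * Sden t z| <= if `|z| <= t then expR (- t) else 0.
Proof.
rewrite le_eqVlt => /predU1P[<-|t0].
  by rewrite /kern invr0 mulr0 mul0r normr0; case: ifP => // _; exact: expR_ge0.
rewrite normrM (ger0_norm (kern_ge0 (ltW t0))) (norm_Sden _ (ltW t0)).
case: ifPn => [zt|]; last first.
  rewrite -ltNge => zt; rewrite (max_idPl _) ?mulr0//; lra.
rewrite -(kernMt t0) ler_wpM2l ?kern_ge0 ?(ltW t0)//.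
by rewrite ge_max (ltW t0)/= gerBl.
Qed.

Lemma measurable_pair_Sden :
  measurable_fun setT (fun p : R * R => Sden p.2 p.1).
Proof.
apply: measurable_fun_ifT.
- exact: measurable_fun_ler.
- by apply: measurable_maxr => //; exact: measurable_funB.
- by apply: measurableT_comp => //; apply: measurable_maxr => //; exact: measurable_funD.
Qed.

Lemma measurable_pair_kern_Sden :
  measurable_fun setT (fun p : R * R => kern p.2 * Sden p.2 p.1).
Proof.
apply: measurable_funM; last exact: measurable_pair_Sden.
exact: measurable_kern_snd.
Qed.

Lemma measurable_kern_Sden z : measurable_fun setT (fun t => kern t * Sden t z).
Proof.
exact: (measurableT_comp measurable_pair_kern_Sden (measurable_pair1 z)).
Qed.

Lemma LI_expRN1 (a : R) : LI `[a, +oo[ (fun t => expR (- t)).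
Proof.
have := @LI_expRN R 1 a ltr01.
by apply: LI_eq => // t _; rewrite mul1r.
Qed.

Lemma Rint_expRN1 (a : R) :
  Rintegral mu `[a, +oo[ (fun t => expR (- t)) = expR (- a).
Proof.
have := @Rint_expRN R 1 a ltr01; rewrite mul1r divr1 => <-.
by apply: eq_Rintegral => t _; rewrite mul1r.
Qed.

Lemma LI_kern_Sden z : LI `[0, +oo[ (fun t => kern t * Sden t z).
Proof.
apply: LI_le (LI_expRN1 0) => //.
  by apply: measurable_funTS; exact: measurable_kern_Sden.
move=> t /=; rewrite in_itv/= andbT => t0.
by apply: le_trans (kern_Sden_bound z t0) _; case: ifP => // _; exact: expR_ge0.
Qed.

Lemma measurable_Sker : measurable_fun setT Sker.
Proof.
apply: measurable_funM => //.
apply: (@measurable_Rintegral_param R `[0, +oo[ (fun z t => kern t * Sden t z)) => //.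
exact: measurable_pair_kern_Sden.
Qed.

Lemma Rint_half_line_if (a : R) (h : R -> R) : 0 <= a ->
  Rintegral mu `[0, +oo[ (fun t => if a <= t then h t else 0) =
  Rintegral mu `[a, +oo[ h.
Proof.
move=> a0; rewrite [LHS]Rintegral_mkcond [RHS]Rintegral_mkcond.
apply: eq_Rintegral => t _; rewrite !patchE !mem_setE !in_itv/= !andbT.
by have [|_] := leP a t; [move=> at_; rewrite (le_trans a0 at_)|case: ifP].
Qed.

(** Since (t - |z|)_+ <= t cancels the singularity of k, the integrand is at most e^(-t) and lives
    on t >= |z|. *)
Lemma Sker_bound z : `|Sker z| <= 2^-1 * expR (- `|z|).
Proof.
rewrite /Sker normrM ger0_norm ?invr_ge0// ler_wpM2l ?invr_ge0//.
rewrite (le_trans (le_normr_Rintegral _ _))//; first exact: LI_kern_Sden.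
rewrite -(Rint_expRN1 `|z|) -Rint_half_line_if//.
have m : measurable_fun (`[0, +oo[%classic : set R)
    (fun t : R => if `|z| <= t then expR (- t) else 0).
  apply: measurable_funTS; apply: measurable_fun_ifT => //.
  - exact: measurable_fun_ler.
  - exact: measurableT_comp.
apply: le_Rintegral => //.
- exact/LI_norm/LI_kern_Sden.
- apply: LI_le (LI_expRN1 0) => // t _.
  by case: ifP => _; rewrite ?normr0 ?expR_ge0// ger0_norm ?expR_ge0.
- by move=> t /=; rewrite in_itv/= andbT; exact: kern_Sden_bound.
Qed.

Lemma Ekernel_ge0 x : 0 <= Ekernel x.
Proof.
rewrite mulr_ge0 ?invr_ge0//.
apply: Rintegral_ge0 => t /=; rewrite in_itv/= andbT => xt.
by rewrite divr_ge0 ?expR_ge0// (le_trans _ xt).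
Qed.

Lemma EkernelE x : Ekernel x =
  2^-1 * Rintegral mu `[0, +oo[ (fun t => if `|x| <= t then kern t else 0).
Proof. by rewrite Rint_half_line_if. Qed.

Lemma EkernelN x : Ekernel (- x) = Ekernel x.
Proof. by rewrite /Ekernel normrN. Qed.

Lemma measurable_pair_box :
  measurable_fun setT (fun p : R * R => if `|p.1| <= p.2 then kern p.2 else 0).
Proof.
apply: measurable_fun_ifT => //.
- by apply: measurable_fun_ler => //; exact: measurableT_comp.
- exact: measurable_kern_snd.
Qed.

Lemma measurable_Ekernel : measurable_fun setT (@Ekernel R).
Proof.
rewrite (funext EkernelE); apply: measurable_funM => //.
apply: (@measurable_Rintegral_param R `[0, +oo[
  (fun x t => if `|x| <= t then kern t else 0)) => //.
exact: measurable_pair_box.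
Qed.

(** At x = 0 the integral is +oo while [fine] makes [Ekernel 0] equal to 0; elsewhere the cutoff t
    >= |x| bounds k(t) by e^(-t)/|x|. *)
Lemma integral_Ekernel_box x : x != 0 ->
  ((Ekernel x)%:E = 2^-1%:E *
    \int[mu]_(t in `[0%R, +oo[) (if `|x| <= t then kern t else 0)%:E)%E.
Proof.
move=> x0; rewrite EkernelE EFinM; congr (_ * _)%E.
rewrite /Rintegral fineK//; apply: integrable_fin_num => //.
have m : measurable_fun (`[0, +oo[%classic : set R)
    (fun t : R => if `|x| <= t then kern t else 0).
  apply: measurable_funTS.
  exact: (measurableT_comp measurable_pair_box (measurable_pair1 x)).
apply: (@LI_le _ _ _ (fun t => `|x|^-1 * expR (- t))) => // [t|]; last first.
  by apply: LI_Z => //; exact: LI_expRN1.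
rewrite /= in_itv/= andbT => t0; case: ifPn => [xt|_]; last first.
  by rewrite normr0 mulr_ge0 ?invr_ge0 ?expR_ge0.
rewrite ger0_norm ?kern_ge0// /kern mulrC ler_wpM2r ?expR_ge0//.
by rewrite lef_pV2 ?posrE ?normr_gt0// (lt_le_trans _ xt)// normr_gt0.
Qed.

(** Tonelli applied to the box mixture: integrating the boxes over D first leaves only lengths of
    intersections. Working in extended reals postpones all finiteness questions. *)
Lemma integral_Ekernel (D : set R) y : measurable D ->
  (\int[mu]_(s in D) (Ekernel (s - y))%:E =
   2^-1%:E * \int[mu]_(t in `[0%R, +oo[)
     ((kern t)%:E * mu (`[(y - t)%R, (y + t)%R] `&` D)))%E.
Proof.
move=> mD.
pose Q (p : R * R) : \bar R :=
  ((if `|p.1 - y| <= p.2 then kern p.2 else 0) * \1_D p.1 *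
    \1_(`[0%R, +oo[%classic : set R) p.2)%:E.
have mB : measurable_fun setT (fun p : R * R => if `|p.1 - y| <= p.2 then kern p.2 else 0).
  apply: measurable_fun_ifT => //.
  - apply: measurable_fun_ler => //; apply: measurableT_comp => //.
    exact: measurable_funB.
  - exact: measurable_kern_snd.
have mQ : measurable_fun setT Q.  
  apply/measurable_EFinP; apply: measurable_funM; first apply: measurable_funM => //.
  - by apply: measurableT_comp => //; exact: measurable_indic.
  - by apply: measurableT_comp => //; exact: measurable_indic.
have Q0 p : (0 <= Q p)%E.
  rewrite lee_fin mulr_ge0//; first rewrite mulr_ge0//.
  by case: ifPn => // h; apply: kern_ge0; exact: le_trans (normr_ge0 _) h.
have Q1 s : s != y ->
    (2^-1%:E * \int[mu]_t Q (s, t) = ((fun s => (Ekernel (s - y))%:E) \_ D) s)%E.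
  move=> sy; rewrite patchE; case: ifPn => [sD|sD]; last first.
    rewrite integral0_eq ?mule0// => t _.
    by rewrite /Q/= indicE (negbTE sD) mulr0 mul0r.
  rewrite integral_Ekernel_box ?subr_eq0//; congr (_ * _)%E.
  rewrite [RHS]integral_mkcond; apply: eq_integral => t _.
  rewrite /Q/= patchE indicE sD mulr1 indicE.
  by case: (t \in _); rewrite ?mulr1 ?mulr0.
have Q2 t : (\int[mu]_s Q (s, t) =
   ((fun t => (kern t)%:E * mu (`[(y - t)%R, (y + t)%R] `&` D)) \_ (`[0%R, +oo[%classic : set R)) t)%E.
  rewrite patchE; case: ifPn => [|tD]; last first.
    by rewrite integral0_eq// => s _; rewrite /Q/= [in X in _ * X]indicE (negbTE tD) mulr0.
  rewrite mem_setE in_itv/= andbT => t0.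
  have mI : measurable (`[(y - t)%R, (y + t)%R] `&` D) by exact: measurableI.
  have -> : mu (`[(y - t)%R, (y + t)%R] `&` D) = (\int[mu]_s (\1_(`[(y - t)%R, (y + t)%R] `&` D) s)%:E)%E.
    by rewrite integral_indic// setIT.
  rewrite -ge0_integralZl//.
  - apply: eq_integral => s _; rewrite /Q/= -EFinM; congr EFin.
    rewrite !indicE in_setI [_ \in `[0, +oo[%classic]mem_set; last by rewrite /= in_itv/= t0.
    rewrite mulr1 mem_setE in_itv/= -ler_distl.
    by case: ifP => _; case: (_ \in _); rewrite /= ?mulr1 ?mulr0 ?mul0r.
  - by apply/measurable_EFinP; exact: measurable_indic.
  - by rewrite lee_fin kern_ge0.
transitivity (\int[mu]_s (2^-1%:E * \int[mu]_t Q (s, t)))%E.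
  (* The mixture formula fails only at s = y, a null set. *)
  rewrite integral_mkcond; apply: ae_eq_integral => //.
  - apply: (measurable_restrictT _ _).1 => //; apply/measurable_EFinP.
    apply: measurable_funTS; apply: (measurableT_comp measurable_Ekernel).
    exact: measurable_funB.
  - apply: emeasurable_funM => //.
    exact: (@measurable_fun_fubini_tonelli_F _ _ _ _ _ mu Q).
  - exists [set y]; split => //; first exact: lebesgue_measure_set1.
    move=> s /=; apply: contra_notP => /eqP sy _.
    by rewrite Q1.
rewrite ge0_integralZl//; last 2 first.
- exact: (@measurable_fun_fubini_tonelli_F _ _ _ _ _ mu Q).
- by move=> s _; exact: integral_ge0.
congr (_ * _)%E; transitivity (\int[mu]_t \int[mu]_s Q (s, t))%E.
  exact: (@fubini_tonelli _ _ _ _ _ mu mu Q mQ Q0).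
rewrite [RHS]integral_mkcond; apply: eq_integral => t _.
exact: Q2.
Qed.

End kernel.

(** * Mass of E and convolution with E on the half-line *)

Section kernel_convolution.
Context {R : realType}.
Notation mu := (@lebesgue_measure R).
Notation Rp := (`[0, +oo[%classic : set R).
Implicit Types (t x y z eta : R).

Lemma LI_kernM : LI Rp (fun t => kern t * t).
Proof.
apply: LI_le (LI_expRN1 0) => //.
  by apply: measurable_funM => //; exact: measurable_kern.
move=> t /=; rewrite in_itv/= andbT le_eqVlt => /predU1P[<-|t0].
  by rewrite mulr0 normr0 expR_ge0.
by rewrite kernMt// ger0_norm// expR_ge0.
Qed.

Lemma Rint_kernM : Rintegral mu Rp (fun t => kern t * t) = 1.
Proof.
rewrite -[RHS](@expR0 R) -[in RHS]oppr0 -Rint_expRN1.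
rewrite -Rintegral_itv_obnd_cbnd; last first.
  by apply: LI_subset LI_kernM => //; apply: subset_itvr; rewrite bnd_simp.
rewrite -[in RHS]Rintegral_itv_obnd_cbnd; last first.
  by apply: LI_subset (LI_expRN1 0) => //; apply: subset_itvr; rewrite bnd_simp.
apply: eq_Rintegral => t; rewrite inE/= in_itv/= andbT => t0.
exact: kernMt.
Qed.

(** A box of half-width t meets D in length at most 2t, and 1/2 \int k(t) 2t dt = \int e^(-t) dt =
    1. *)
Lemma integral_Ekernel_le1 (D : set R) y : measurable D ->
  (\int[mu]_(s in D) (Ekernel (s - y))%:E <= 1)%E.
Proof.
move=> mD; rewrite integral_Ekernel//.
have -> : 1%E = (2^-1%:E * \int[mu]_(t in Rp) (2 * (kern t * t))%:E)%E :> \bar R.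
  under eq_integral do rewrite EFinM.
  rewrite integralZl//; last exact: LI_kernM.
  rewrite muleA -EFinM mulVf ?mul1e//.
  rewrite -[RHS]fineK; first by rewrite -/(Rintegral _ _ _) Rint_kernM.
  by apply: integrable_fin_num => //; exact: LI_kernM.
apply: lee_wpmul2l; first by rewrite lee_fin invr_ge0.
have mI t : measurable (`[(y - t)%R, (y + t)%R] `&` D) by exact: measurableI.
have le t : 0 <= t -> (mu (`[(y - t)%R, (y + t)%R] `&` D) <= (2 * t)%:E)%E.
  move=> t0; apply: (@le_trans _ _ (mu `[(y - t)%R, (y + t)%R])).
    apply: le_measure; [rewrite inE; exact: mI|by rewrite inE|exact: subIsetl].
  rewrite lebesgue_measure_itv/= lte_fin.
  by case: ifP => _; rewrite ?lee_fin -?EFinD ?lee_fin; lra.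
apply: ge0_le_integral => //.
- move=> t /=; rewrite in_itv/= andbT => t0.
  by rewrite mule_ge0// lee_fin kern_ge0.
- apply: emeasurable_funM.
    by apply/measurable_EFinP; exact: measurable_kern.
  apply: measurable_funTS.
  (* The overlap length is the measure of the section of [A] at t, hence measurable in t. *)
  pose A : set (R * R) := [set p | (`|p.2 - y| <= p.1) && (p.2 \in D)].
  have mA : measurable A.
    have mb : measurable_fun setT (fun p : R * R => (`|p.2 - y| <= p.1) && (p.2 \in D)).
      apply: measurable_and.
        apply: measurable_fun_ler => //; apply: measurableT_comp => //.
        exact: measurable_funB.
      apply: (measurableT_comp (f := fun x => x \in D)) => //.
      by apply: (measurable_fun_bool true); rewrite setTI (_ : _ @^-1` _ = D)//;
        apply/seteqP; split => x /=; [exact: set_mem|exact: mem_set].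
    have := mb measurableT [set true] I; rewrite setTI.
    by rewrite (_ : _ @^-1` _ = A).
  have := @measurable_fun_xsection _ _ _ _ _ mu A mA.
  rewrite (_ : _ \o _ = fun t => mu (`[(y - t)%R, (y + t)%R] `&` D))//.
  apply/funext => t /=; congr (mu _); apply/seteqP; split => x /=.
    rewrite /xsection/= inE /A/= ler_distl => /andP[xt]; rewrite inE => xD.
    by rewrite in_itv/=.
  rewrite in_itv/= => -[xt xD].
  by rewrite /xsection/= inE /A/= ler_distl xt/= inE.
- apply/measurable_EFinP; apply: measurable_funM => //.
  by apply: measurable_funM => //; exact: measurable_kern.
- move=> t /=; rewrite in_itv/= andbT => t0.
  have -> : (2 * (kern t * t))%:E = ((kern t)%:E * (2 * t)%:E)%E.
    by rewrite -EFinM; congr EFin; ring.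
  by apply: lee_wpmul2l; [rewrite lee_fin kern_ge0|exact: le].
Qed.

Lemma measurable_Ekernel_sub (D : set R) y :
  measurable_fun D (fun s => Ekernel (s - y)).
Proof.
apply: measurable_funTS; apply: (measurableT_comp measurable_Ekernel).
exact: measurable_funB.
Qed.

Lemma LI_Ekernel_sub (D : set R) y : measurable D ->
  LI D (fun s => Ekernel (s - y)).
Proof.
move=> mD; apply/integrableP; split.
  by apply/measurable_EFinP; exact: measurable_Ekernel_sub.
under eq_integral => t _ do rewrite /= ger0_norm ?Ekernel_ge0//.
by apply: le_lt_trans (integral_Ekernel_le1 y mD) _; rewrite ltry.
Qed.

Lemma Rint_Ekernel_le1 (D : set R) y : measurable D ->
  Rintegral mu D (fun s => Ekernel (s - y)) <= 1.
Proof.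
move=> mD; rewrite -lee_fin /Rintegral fineK; first exact: integral_Ekernel_le1.
by apply: integrable_fin_num => //; exact: LI_Ekernel_sub.
Qed.

(** From the full length 2t (when eta lies in [0, y]) or 0 (when it lies beyond y), correct for what
    sticks out at y and at 0. The sign built into [Sden] lets one formula serve both cases. *)
Lemma itv_overlap t y eta : 0 <= t -> 0 <= y -> 0 <= eta ->
  mu (`[(eta - t)%R, (eta + t)%R] `&` `[0%R, y]) =
  ((if eta <= y then 2 * t else 0) - Sden t (y - eta) - Sden t eta)%:E.
Proof.
move=> t0 y0 eta0.
have -> : `[(eta - t)%R, (eta + t)%R]%classic `&` `[0%R, y]%classic =
    `[Num.max (eta - t) 0, Num.min (eta + t) y]%classic :> set R.
  apply/seteqP; split => x /=; rewrite !in_itv/= ge_max le_min.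
    by move=> [/andP[-> ->] /andP[-> ->]].
  by move=> /andP[/andP[-> ->] /andP[-> ->]].
rewrite lebesgue_measure_itv/= lte_fin /Sden eta0 subr_ge0.
have [h1|h1] := leP eta y; have [h2|h2] := leP 0 (eta - t);
  have [h3|h3] := leP (eta + t) y; have [h4|h4] := leP 0 (t - eta);
  (try (have [h5|h5] := leP 0 (t - (y - eta))));
  (try (have [h6|h6] := leP 0 (t + (y - eta))));
  (case: ltP => h7; rewrite -?EFinD -?EFinB; congr EFin; lra).
Qed.

(** The integrated form of delta - E = S'. The closed condition eta <= y matches the choice of the
    right limit for S at 0, so the identity holds at eta = y too. *)
Lemma Rint_Ekernel y eta : 0 <= y -> 0 <= eta ->
  Rintegral mu `[0, y] (fun s => Ekernel (s - eta)) =
  (if eta <= y then 1 else 0) - Sker (y - eta) - Sker eta.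
Proof.
move=> y0 eta0; rewrite {1}/Rintegral integral_Ekernel//.
set b : R := if eta <= y then 2 else 0.
have -> : (\int[mu]_(t in Rp)
      ((kern t)%:E * mu (`[(eta - t)%R, (eta + t)%R] `&` `[0%R, y])) =
    \int[mu]_(t in Rp) (b * (kern t * t) - kern t * Sden t (y - eta) -
      kern t * Sden t eta)%:E)%E.
  apply: eq_integral => t; rewrite inE/= in_itv/= andbT => t0.
  rewrite itv_overlap// -EFinM; congr EFin.
  by rewrite /b; case: ifP => _; ring.
have l1 : LI Rp (fun t => b * (kern t * t)) by apply: LI_Z => //; exact: LI_kernM.
have l2 z : LI Rp (fun t => kern t * Sden t z) by exact: LI_kern_Sden.
rewrite fineM//; last first.
  by apply: integrable_fin_num => //; apply: LI_B => //; apply: LI_B.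
rewrite -/(Rintegral mu Rp (fun t => b * (kern t * t) - kern t * Sden t (y - eta) -
  kern t * Sden t eta)).
have l3 : LI Rp (fun t => b * (kern t * t) - kern t * Sden t (y - eta)).
  exact: LI_B.
rewrite (RintegralB _ l3 (l2 eta))// (RintegralB _ l1 (l2 _))//.
rewrite (RintegralZl b _ LI_kernM)//.
rewrite Rint_kernM /Sker /= /b; case: ifP => _; lra.
Qed.

Lemma gsrcE (f : R -> R) y :
  gsrc f y = - Rintegral mu Rp (fun eta => Ekernel (eta - y) * f eta ^+ 4).
Proof.
have <- : Rintegral mu Rp (fun eta => Ekernel (y - eta) * f eta ^+ 4) =
    Rintegral mu Rp (fun eta => Ekernel (eta - y) * f eta ^+ 4).
  by apply: eq_Rintegral => eta _; rewrite -(EkernelN (y - eta)) opprB.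
by [].
Qed.

Lemma measurable_pair_conv (u : R -> R) : measurable_fun setT u ->
  measurable_fun setT (fun p : R * R => Ekernel (p.2 - p.1) * u p.2).
Proof.
move=> mu_; apply: measurable_funM; last first.
  exact: (measurableT_comp mu_ measurable_snd).
apply: (measurableT_comp measurable_Ekernel).
by apply: measurable_funB.
Qed.

Lemma LI_conv (u : R -> R) (U : R) y : measurable_fun Rp u ->
  (forall x, 0 <= x -> 0 <= u x <= U) ->
  LI Rp (fun eta => Ekernel (eta - y) * u eta).
Proof.
move=> mf uU; apply: (@LI_eq _ _ (fun eta => u eta * Ekernel (eta - y))) => //.
  by move=> x _; rewrite mulrC.
apply: (@LI_mul_bounded _ _ _ _ U) => //; last exact: LI_Ekernel_sub.
move=> x /=; rewrite in_itv/= andbT => /uU /andP[u0 uU'].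
by rewrite ger0_norm.
Qed.

Lemma Rint_conv_bound (u : R -> R) (U : R) y : measurable_fun Rp u ->
  (forall x, 0 <= x -> 0 <= u x <= U) ->
  0 <= Rintegral mu Rp (fun eta => Ekernel (eta - y) * u eta) <= U.
Proof.
move=> mf uU; apply/andP; split.
  apply: Rintegral_ge0 => x /=; rewrite in_itv/= andbT => /uU /andP[u0 _].
  by rewrite mulr_ge0// Ekernel_ge0.
have U0 : 0 <= U by have /andP[] := uU 0 (lexx _); exact: le_trans.
rewrite (@le_trans _ _ (Rintegral mu Rp (fun eta => U * Ekernel (eta - y))))//.
  apply: le_Rintegral => //; first exact: LI_conv uU.
    by apply: LI_Z => //; exact: LI_Ekernel_sub.
  move=> x /=; rewrite in_itv/= andbT => /uU /andP[_ uU'].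
  by rewrite mulrC ler_wpM2r// Ekernel_ge0.
rewrite RintegralZl//; last exact: LI_Ekernel_sub.
by rewrite ler_piMr// Rint_Ekernel_le1.
Qed.

Lemma gsrc_bound (f : R -> R) (M : R) y : measurable_fun Rp f ->
  (forall x, 0 <= x -> 0 <= f x <= M) -> - M ^+ 4 <= gsrc f y <= 0.
Proof.
move=> mf fM; rewrite gsrcE.
have mf4 : measurable_fun Rp (fun x => f x ^+ 4) by exact: measurable_funX.
have h x : 0 <= x -> 0 <= f x ^+ 4 <= M ^+ 4.
  move=> /fM /andP[f0 fM']; rewrite exprn_ge0//= lerXn2r// nnegrE//.
  exact: le_trans fM'.
have /andP[h1 h2] := Rint_conv_bound y mf4 h.
by rewrite lerN2 h2 oppr_le0.
Qed.

Lemma measurable_gsrc (f : R -> R) : measurable_fun Rp f ->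
  measurable_fun setT (gsrc f).
Proof.
move=> mf.
have -> : gsrc f = fun y => -1 * Rintegral mu Rp
    (fun eta => Ekernel (eta - y) * (fun x => (f \_ Rp) x ^+ 4) eta).
  apply/funext => y; rewrite gsrcE mulN1r; congr (- _).
  by apply: eq_Rintegral => x xR; rewrite patchE ifT.
have m : measurable_fun setT (fun x => (f \_ Rp) x ^+ 4).
  by apply: measurable_funX; apply: (measurable_restrictT _ _).1.
apply: measurable_funM => //.
apply: (@measurable_Rintegral_param R Rp
  (fun y eta => Ekernel (eta - y) * (fun x => (f \_ Rp) x ^+ 4) eta)) => //.
exact: (measurable_pair_conv m).
Qed.

(** E is unbounded near 0, so the product majorant of [Rintegral_fubini] is out of reach. On the
    half-line the integrand is nonnegative instead, and its inner integral is at most U. *)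
Lemma Rint_conv_swap (u : R -> R) (U : R) y : 0 <= y -> measurable_fun setT u ->
  (forall x, 0 <= x -> 0 <= u x <= U) ->
  Rintegral mu `[0, y]
    (fun s => Rintegral mu Rp (fun eta => Ekernel (eta - s) * u eta)) =
  Rintegral mu Rp (fun eta => u eta *
    ((if eta <= y then 1 else 0) - Sker (y - eta) - Sker eta)).
Proof.
move=> y0 mu_ uU.
have mu' : measurable_fun Rp u by exact: measurable_funTS.
have [||||||_ ->] := @Rintegral_swap R `[0, y] Rp (fun s eta => Ekernel (eta - s) * u eta).
- by [].
- by [].
- exact: (measurable_pair_conv mu_).
- by move=> s _; exact: LI_conv uU.
- move=> eta _; apply: (@LI_eq _ _ (fun s => u eta * Ekernel (s - eta))) => //.
    by move=> s _; rewrite mulrC -EkernelN opprB.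
  by apply: LI_Z => //; exact: LI_Ekernel_sub.
- have nE s : Rintegral mu Rp (fun eta => `|Ekernel (eta - s) * u eta|) =
      Rintegral mu Rp (fun eta => Ekernel (eta - s) * u eta).
    apply: eq_Rintegral => x; rewrite inE/= in_itv/= andbT => /uU /andP[u0 _].
    by rewrite ger0_norm// mulr_ge0// Ekernel_ge0.
  apply: (@LI_itv_bounded _ _ _ _ U).
    apply: measurable_funTS.
    apply: (@measurable_Rintegral_param R Rp (fun s eta => `|Ekernel (eta - s) * u eta|)) => //.
    have mc := measurable_pair_conv mu_.
    exact: measurableT_comp.
  move=> s _; rewrite nE; have /andP[h1 h2] := Rint_conv_bound s mu' uU.
  by rewrite ger0_norm.
apply: eq_Rintegral => eta; rewrite inE/= in_itv/= andbT => eta0.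
rewrite -Rint_Ekernel// -RintegralZl//; last exact: LI_Ekernel_sub.
by apply: eq_Rintegral => s _; rewrite mulrC -EkernelN opprB.
Qed.

End kernel_convolution.

(** * Tents as test functions *)

Section tent_functions.
Context {R : realType}.
Notation mu := (@lebesgue_measure R).
Implicit Types (s m t x y : R).

(** The piecewise linear bump of height 1 at m supported in [s, t]. Writing it with ramps makes its
    density a combination of indicators of rays, whose integral against a density [l] is a
    difference of two slopes of its primitive. *)
Definition tent s m t y : R :=
  (m - s)^-1 * (Num.max 0 (y - s) - Num.max 0 (y - m)) -
  (t - m)^-1 * (Num.max 0 (y - m) - Num.max 0 (y - t)).

Definition dtent s m t y : R :=
  (m - s)^-1 * (\1_`[s, +oo[ y - \1_`[m, +oo[ y) -
  (t - m)^-1 * (\1_`[m, +oo[ y - \1_`[t, +oo[ y).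

Lemma prim_tent s m t : prim (tent s m t) (dtent s m t).
Proof.
by apply: prim_B; apply: prim_Z; apply: prim_B; exact: prim_ramp.
Qed.

Lemma indic_ray a y : \1_(`[a, +oo[%classic : set R) y = if a <= y then 1 else 0 :> R.
Proof. by rewrite indicE mem_setE in_itv/= andbT; case: (a <= y). Qed.

Lemma tent_bound s m t y : s < m -> m < t -> 0 <= tent s m t y <= 1.
Proof.
move=> sm mt; rewrite /tent.
have a0 : 0 < (m - s)^-1 by rewrite invr_gt0 subr_gt0.
have b0 : 0 < (t - m)^-1 by rewrite invr_gt0 subr_gt0.
have a1 : (m - s)^-1 * (m - s) = 1 by rewrite mulVf// gt_eqF// subr_gt0.
have b1 : (t - m)^-1 * (t - m) = 1 by rewrite mulVf// gt_eqF// subr_gt0.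
move: (m - s)^-1 (t - m)^-1 a0 b0 a1 b1 => a b a0 b0 a1 b1.
have [h1|h1] := leP 0 (y - s); have [h2|h2] := leP 0 (y - m);
  have [h3|h3] := leP 0 (y - t); try (exfalso; lra); apply/andP; split; try nra.
Qed.

Lemma tent_eq0 s m t y : s < m -> m < t -> t <= y -> tent s m t y = 0.
Proof.
move=> sm mt ty; rewrite /tent !(max_idPr _); try lra.
field; rewrite !gt_eqF//= subr_gt0//.
Qed.

Lemma tent0 s m t : 0 <= s -> s < m -> m < t -> tent s m t 0 = 0.
Proof.
move=> s0 sm mt; rewrite /tent !(max_idPl _); try lra.
Qed.

Lemma dtent_eq0 s m t y : s < m -> m < t -> t <= y -> dtent s m t y = 0.
Proof.
move=> sm mt ty; rewrite /dtent !indic_ray ty (le_trans (ltW mt) ty).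
by rewrite (le_trans (ltW (lt_trans sm mt)) ty); ring.
Qed.

Lemma dtent_bound s m t y : s < m -> m < t ->
  `|dtent s m t y| <= (m - s)^-1 + (t - m)^-1.
Proof.
move=> sm mt; rewrite /dtent !indic_ray.
have a0 : 0 < (m - s)^-1 by rewrite invr_gt0 subr_gt0.
have b0 : 0 < (t - m)^-1 by rewrite invr_gt0 subr_gt0.
by rewrite ler_norml; do 3 case: ifP => _; apply/andP; split; lra.
Qed.

Lemma measurable_dtent s m t (D : set R) : measurable_fun D (dtent s m t).
Proof.
by apply: measurable_funB; apply: measurable_funM => //;
  apply: measurable_funB; exact: measurable_indic.
Qed.

Lemma Rint_mul_dtent L l s m t : prim L l -> 0 <= s -> s < m -> m < t ->
  Rintegral mu `[0, t] (fun y => l y * dtent s m t y) =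
  (L m - L s) / (m - s) - (L t - L m) / (t - m).
Proof.
move=> pL s0 sm mt.
have t0 : 0 <= t by lra.
have [ll _] := pL t t0.
have lray a : LI `[0, t] (fun y => l y * \1_`[a, +oo[ y).
  apply: (@LI_eq _ _ (fun y => \1_`[a, +oo[ y * l y)) => // [x _|].
    exact: mulrC.
  apply: (@LI_mul_bounded _ _ _ _ 1) => //.
  by move=> x _; rewrite indic_ray; case: ifP; rewrite ?normr1 ?normr0.
have ray a : 0 <= a <= t ->
    Rintegral mu `[0, t] (fun y => l y * \1_`[a, +oo[ y) = L t - L a.
  move=> /andP[a0 at_]; rewrite (prim_sub pL)// -Rint_if_ge ?a0//.
  apply: eq_Rintegral => y _; rewrite indic_ray.
  by case: ifP => _; rewrite ?mulr1 ?mulr0.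
transitivity (Rintegral mu `[0, t] (fun y =>
    (m - s)^-1 * (l y * \1_`[s, +oo[ y - l y * \1_`[m, +oo[ y) -
    (t - m)^-1 * (l y * \1_`[m, +oo[ y - l y * \1_`[t, +oo[ y))).
  by apply: eq_Rintegral => y _; rewrite /dtent; ring.
have lB a b : LI `[0, t] (fun y => l y * \1_`[a, +oo[ y - l y * \1_`[b, +oo[ y).
  exact: LI_B.
have lZ k a b : LI `[0, t]
    (fun y => k * (l y * \1_`[a, +oo[ y - l y * \1_`[b, +oo[ y)).
  exact: LI_Z.
rewrite (RintegralB _ (lZ _ _ _) (lZ _ _ _))//.
rewrite !(RintegralZl _ _ (lB _ _))//.
rewrite !(RintegralB _ (lray _) (lray _))// !ray; lra.
Qed.

End tent_functions.

(** * First variation of the energy along tents *)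

Section first_variation.
Context {R : realType}.
Notation mu := (@lebesgue_measure R).
Notation Rp := (`[0, +oo[%classic : set R).
Variables (c TM A : R) (gn : R -> R).
Hypothesis c0 : 0 < c.
Hypothesis mgn : measurable_fun setT gn.
Hypothesis gnA : forall y, `|gn y| <= A.

Let v (y : R) : R := expR (- (c * y)).

Let v_ge0 y : 0 <= v y. Proof. exact: expR_ge0. Qed.

Let v_le1 y : 0 <= y -> v y <= 1.
Proof. by move=> y0; rewrite /v -expR0 ler_expR oppr_le0 mulr_ge0// ltW. Qed.

Let mv D : measurable_fun D v.
Proof. exact: measurable_expRN. Qed.

Lemma admissible_prim f g : admissible c TM f g -> prim f g.
Proof.
by move=> [_ [f0 [lg [fE _]]]] y y0; rewrite f0; split; [exact: lg|exact: fE].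
Qed.

Let edens (f g : R -> R) y : R :=
  v y * (g y ^+ 2 / 2 + f y ^+ 5 / 5 + gn y * f y).

(** Finite energies allow the minimality inequality to be subtracted as real numbers. The linear
    term is controlled by |f| <= 1 + f^2 and the integrability of e^(-cy). *)
Lemma admissible_energy_LI f g : admissible c TM f g -> LI Rp (edens f g).
Proof.
move=> af; have pf := admissible_prim af.
have [_ [_ [_ [_ [lg2 [lf2 lf5]]]]]] := af.
have mf := prim_measurable pf.
apply: (@LI_eq _ _ (fun y => 2^-1 * (v y * g y ^+ 2) + 5^-1 * (v y * f y ^+ 5)
   + v y * (gn y * f y))) => // [y _|]; first by rewrite /edens; ring.
apply: LI_D => //; first by apply: LI_D => //; apply: LI_Z.
apply: (@LI_le _ _ _ (fun y => A * (v y + v y * f y ^+ 2))) => //.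
- apply: measurable_funM; first exact: mv.
  by apply: measurable_funM => //; exact: measurable_funTS.
- move=> y _; rewrite normrM (ger0_norm (v_ge0 y)) normrM.
  have h : `|f y| <= 1 + f y ^+ 2.
    have := normr_ge0 (f y); rewrite -(real_normK (num_real (f y))); nra.
  have := gnA y; have := v_ge0 y; have := normr_ge0 (gn y) => h1 h2 h3.
  have -> : A * (v y + v y * f y ^+ 2) = v y * (A * (1 + f y ^+ 2)) by ring.
  by rewrite ler_wpM2l// ler_pM.
- by apply: LI_Z => //; apply: LI_D => //; exact: LI_expRN.
Qed.

(** Taylor expansion in d with an explicit remainder: 26 = 10 + 10 + 5 + 1 collects the binomial
    coefficients of (a + d p)^5 beyond first order, with |d p| <= M; the factors 1/2 and 1/5 are
    bounded by 1. *)
Lemma edens_variation (a b p q d gy w M : R) : 0 <= w <= 1 -> `|d| <= 1 ->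
  `|a| <= M -> `|p| <= M -> `|q| <= M ->
  w * ((b + d * q) ^+ 2 / 2 + (a + d * p) ^+ 5 / 5 + gy * (a + d * p)) -
  w * (b ^+ 2 / 2 + a ^+ 5 / 5 + gy * a) <=
  d * (b * (w * q) + (a ^+ 4 + gy) * (w * p)) + d ^+ 2 * (M ^+ 2 + 26 * M ^+ 5).
Proof.
move=> /andP[w0 w1] d1 aM pM qM.
pose r := q ^+ 2 / 2 + p ^+ 2 * (10 * a ^+ 3 + 10 * a ^+ 2 * (d * p)
   + 5 * a * (d * p) ^+ 2 + (d * p) ^+ 3) / 5.
have -> : w * ((b + d * q) ^+ 2 / 2 + (a + d * p) ^+ 5 / 5 + gy * (a + d * p)) -
  w * (b ^+ 2 / 2 + a ^+ 5 / 5 + gy * a) =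
  d * (b * (w * q) + (a ^+ 4 + gy) * (w * p)) + d ^+ 2 * (w * r).
  by rewrite /r; field.
rewrite lerD2l ler_wpM2l ?sqr_ge0//.
have M0 : 0 <= M by exact: le_trans aM.
have dpM : `|d * p| <= M by rewrite normrM -[M]mul1r ler_pM.
have X n x : `|x| <= M -> `|x ^+ n| <= M ^+ n.
  by move=> xM; rewrite normrX lerXn2r// nnegrE.
have rM : `|r| <= M ^+ 2 + 26 * M ^+ 5.
  have h1 : `|q ^+ 2 / 2| <= M ^+ 2.
    rewrite normrM (@ger0_norm _ (2^-1))// -[leRHS]mulr1 ler_pM ?X//.
    by rewrite invf_le1// ler1n.
  have h2 : `|10 * a ^+ 3 + 10 * a ^+ 2 * (d * p) + 5 * a * (d * p) ^+ 2
      + (d * p) ^+ 3| <= 26 * M ^+ 3.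
    have k1 : `|10 * a ^+ 3| <= 10 * M ^+ 3.
      by rewrite normrM ger0_norm// ler_wpM2l// X.
    have k2 : `|10 * a ^+ 2 * (d * p)| <= 10 * M ^+ 3.
      rewrite -mulrA normrM ger0_norm// ler_wpM2l// (exprSr M 2) normrM ler_pM//.
      exact: X.
    have k3 : `|5 * a * (d * p) ^+ 2| <= 5 * M ^+ 3.
      rewrite -mulrA normrM ger0_norm// ler_wpM2l// (exprS M 2) normrM ler_pM//.
      exact: X.
    have k4 := X 3 _ dpM.
    rewrite (le_trans (ler_normD _ _))//.
    rewrite (le_trans (lerD (ler_normD _ _) (lexx _)))//.
    rewrite (le_trans (lerD (lerD (ler_normD _ _) (lexx _)) (lexx _)))//; lra.
  rewrite (le_trans (ler_normD _ _))// lerD//.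
  rewrite normrM (@ger0_norm _ (5^-1))//.
  rewrite (@le_trans _ _ (M ^+ 2 * (26 * M ^+ 3) * 1))//.
    rewrite ler_pM ?normr_ge0 ?invr_ge0//; last by rewrite invf_le1// ler1n.
    by rewrite normrM ler_pM// X.
  by rewrite mulr1 mulrCA -exprD.
rewrite (le_trans (ler_norm _))// normrM (ger0_norm w0) (le_trans _ rM)//.
by rewrite -[leRHS]mul1r ler_wpM2r.
Qed.

Variables (f g : R -> R).
Hypothesis af : admissible c TM f g.
Hypothesis minf : forall h gh, admissible c TM h gh ->
  (energy c gn f g <= energy c gn h gh)%E.

Let pf : prim f g := admissible_prim af.
Let mf : measurable_fun Rp f := prim_measurable pf.

Lemma LI_source y : LI `[0, y] (fun x => f x ^+ 4 + gn x).
Proof.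
have [y0|y0] := leP 0 y; last first.
  rewrite set_itv_ge -?leNgt ?bnd_simp -?ltNge//.
  exact: integrable_set0.
have [B B0 fB] := prim_bounded pf y0.
apply: (@LI_itv_bounded _ _ _ _ (B ^+ 4 + A)).
  apply: measurable_funD; last exact: measurable_funTS.
  by apply: measurable_funX; exact: measurable_itvW.
move=> x xy; rewrite (le_trans (ler_normD _ _))// lerD//.
by rewrite normrX lerXn2r// ?nnegrE ?(ltW B0)// fB.
Qed.

Definition ELprim y : R := Rintegral mu `[0, y] (fun x => f x ^+ 4 + gn x).

Lemma prim_ELprim : prim ELprim (fun x => f x ^+ 4 + gn x).
Proof.
apply: prim_eq (prim_int 0 (fun y _ => LI_source y)) _ _ => // y _.
by rewrite add0r.
Qed.

(** Its formal second derivative f'' - c f' - (f^4 + gn) is the residual of the equation, so the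
    equation becomes affinity of [ELres], which makes sense without f''. *)
Definition ELres y : R := f y - c * Rintegral mu `[0, y] f -
  Rintegral mu `[0, y] ELprim.

Lemma prim_ELres : prim ELres (fun y => g y - c * f y - ELprim y).
Proof.
apply: prim_B; first apply: prim_B => //.
- apply: prim_Z.
  apply: prim_eq (prim_int 0 (prim_LI_int pf)) _ _ => // y _.
  by rewrite add0r.
- apply: prim_eq (prim_int 0 (prim_LI_int prim_ELprim)) _ _ => // y _.
  by rewrite add0r.
Qed.

Section tent_variation.
Variables (s m t : R).
Hypotheses (s0 : 0 <= s) (sm : s < m) (mt : m < t).

Let chi := tent s m t.
Let theta := dtent s m t.
(** The factor e^(cy) cancels the weight of the energy, so that the variation is tested against the
    plain tent. *)
Let phi y := expR (c * y) * chi y.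
Let psi y := c * expR (c * y) * chi y + expR (c * y) * theta y.

Let t0 : 0 <= t. Proof. exact: le_trans s0 (ltW (lt_trans sm mt)). Qed.

Let pphi : prim phi psi.
Proof. by apply: prim_mul; [exact: prim_expR|exact: prim_tent]. Qed.

Let vexp y : v y * expR (c * y) = 1.
Proof. by rewrite /v -expRD addNr expR0. Qed.

Let vphi y : v y * phi y = chi y.
Proof. by rewrite mulrA vexp mul1r. Qed.

Let vpsi y : v y * psi y = c * chi y + theta y.
Proof.
have -> : v y * psi y = (v y * expR (c * y)) * (c * chi y + theta y).
  by rewrite /psi; ring.
by rewrite vexp mul1r.
Qed.

Let phi_out y : t <= y -> phi y = 0.
Proof. by move=> ty; rewrite /phi /chi tent_eq0// mulr0. Qed.

Let psi_out y : t <= y -> psi y = 0.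
Proof.
by move=> ty; rewrite /psi /chi /theta tent_eq0// dtent_eq0// !mulr0 addr0.
Qed.

Let mphi : measurable_fun (`[0, t]%classic : set R) phi.
Proof. by apply: measurable_itvW; exact: (prim_measurable pphi). Qed.

Let mpsi : measurable_fun (`[0, t]%classic : set R) psi.
Proof. by have [/LI_measurable] := pphi t0. Qed.

Let bounds : exists2 M, 0 < M &
  forall y, 0 <= y <= t -> [/\ `|f y| <= M, `|phi y| <= M & `|psi y| <= M].
Proof.
have [B1 B10 h1] := prim_bounded pf t0.
have [B2 B20 h2] := prim_bounded pphi t0.
pose e := expR (c * t); pose k := c + ((m - s)^-1 + (t - m)^-1).
have k0 : 0 <= k by rewrite !addr_ge0 ?ltW// invr_gt0 subr_gt0.
have e0 : 0 <= e by exact: expR_ge0.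
exists (B1 + B2 + e * k); first by rewrite ltr_wpDr ?mulr_ge0// addr_gt0.
move=> y yt; have ek : 0 <= e * k by exact: mulr_ge0.
split.
- by apply: le_trans (h1 y yt) _; lra.
- by apply: le_trans (h2 y yt) _; lra.
- apply: (@le_trans _ _ (e * k)); last lra.
  have -> : psi y = expR (c * y) * (c * chi y + theta y) by rewrite /psi; ring.
  have /andP[y0 yt'] := yt.
  rewrite normrM ger0_norm ?expR_ge0//.
  rewrite ler_pM ?expR_ge0// ?ler_expR ?ler_wpM2l ?(ltW c0)//.
  rewrite (le_trans (ler_normD _ _))// lerD ?dtent_bound//.
  have /andP[x0 x1] := tent_bound y sm mt.
  rewrite normrM (ger0_norm (ltW c0)) (ger0_norm x0).
  by rewrite -[leRHS]mulr1 ler_wpM2l// ltW.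
Qed.

Let dir y := g y * (v y * psi y) + (f y ^+ 4 + gn y) * (v y * phi y).

(** [phi] vanishes at 0 and beyond t, so the boundary value and the weighted integrability survive,
    and only the sign constraint is at stake. *)
Lemma variation_admissible d : (forall y, 0 <= y -> 0 <= f y + d * phi y) ->
  admissible c TM (fun y => f y + d * phi y) (fun y => g y + d * psi y).
Proof.
move=> hpos; have ph := prim_D pf (prim_Z d pphi).
have [_ [f0 [_ [_ [lg2 [lf2 lf5]]]]]] := af.
have [M M0 bM] := bounds.
have phi0 : phi 0 = 0 by rewrite /phi /chi tent0// mulr0.
have lpow n : LI `[0, t] (fun y => v y * (f y + d * phi y) ^+ n).
  have [B B0 hB] := prim_bounded ph t0.
  apply: (@LI_itv_bounded _ _ _ _ (B ^+ n)).
    apply: measurable_funM; first exact: mv.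
    apply: measurable_funX; apply: measurable_funD; first exact: measurable_itvW.
    exact: measurable_funM.
  move=> y /andP[y0 yt]; rewrite normrM (ger0_norm (v_ge0 y)) -[leRHS]mul1r.
  rewrite ler_pM// ?v_le1// normrX lerXn2r ?nnegrE ?(ltW B0)//.
  by rewrite hB ?y0.
have pat (F F' : R -> R) (n : nat) : (forall y, t < y -> F' y = F y) ->
    LI `[0, t] (fun y => v y * F' y ^+ n) ->
    LI Rp (fun y => v y * F y ^+ n) -> LI Rp (fun y => v y * F' y ^+ n).
  move=> FF l1 l2; apply: (LI_half_line_patch t0 l2 l1) => y ty.
  by rewrite FF.
split; first exact: hpos.
split; first by rewrite phi0 mulr0 addr0.
split; first by move=> y /ph[].
split; first by move=> y /ph[_ ->]; rewrite phi0 mulr0 addr0 f0.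
split; last split.
- apply: (pat g) => //; first by move=> y /ltW /psi_out ->; rewrite mulr0 addr0.
  have lg : LI `[0, t] g by have [] := pf t0.
  apply: (@LI_eq _ _ (fun y => v y * g y ^+ 2 + ((2 * d) * (v y * psi y) * g y
     + d ^+ 2 * (v y * psi y ^+ 2)))) => // [y _|]; first by ring.
  have mvpsi : measurable_fun (`[0, t]%classic : set R) (fun y => v y * psi y).
    by apply: measurable_funM => //; exact: mv.
  apply: LI_D => //; first exact: LI_subset_half_line.
  apply: LI_D => //.
    apply: (@LI_mul_bounded _ _ _ _ (`|2 * d| * M)) => //.
      exact: measurable_funM.
    move=> y /=; rewrite in_itv/= => yt; have [_ _ pM] := bM y yt.
    rewrite normrM ler_wpM2l// normrM (ger0_norm (v_ge0 y)).
    by have /andP[y0 _] := yt; rewrite -[leRHS]mul1r ler_pM// v_le1.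
  apply: LI_Z => //; apply: (@LI_itv_bounded _ _ _ _ (M ^+ 2)).
    by apply: measurable_funM; [exact: mv|exact: measurable_funX].
  move=> y yt; have [_ _ pM] := bM y yt; have /andP[y0 _] := yt.
  rewrite normrM (ger0_norm (v_ge0 y)) -[leRHS]mul1r ler_pM ?v_le1//.
  by rewrite normrX lerXn2r ?nnegrE ?(ltW M0).
- by apply: (pat f) => // y /ltW /phi_out ->; rewrite mulr0 addr0.
- by apply: (pat f) => // y /ltW /phi_out ->; rewrite mulr0 addr0.
Qed.

Let LI_dir : LI `[0, t] dir.
Proof.
have [M M0 bM] := bounds; have [lg _] := pf t0.
apply: LI_D => //.
  apply: (@LI_eq _ _ (fun y => v y * psi y * g y)) => // [y _|].
    exact: mulrC.
  apply: (@LI_mul_bounded _ _ _ _ M) => //.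
    by apply: measurable_funM => //; exact: mv.
  move=> y /=; rewrite in_itv/= => yt; have [_ _ pM] := bM y yt.
  rewrite normrM (ger0_norm (v_ge0 y)) -[leRHS]mul1r.
  by have /andP[y0 _] := yt; rewrite ler_pM ?v_le1.
apply: (@LI_eq _ _ (fun y => v y * phi y * (f y ^+ 4 + gn y))) => // [y _|].
  exact: mulrC.
apply: (@LI_mul_bounded _ _ _ _ M) => //; last exact: LI_source.
  by apply: measurable_funM => //; exact: mv.
move=> y /=; rewrite in_itv/= => yt; have [_ pM _] := bM y yt.
rewrite normrM (ger0_norm (v_ge0 y)) -[leRHS]mul1r.
by have /andP[y0 _] := yt; rewrite ler_pM ?v_le1.
Qed.

(** Beyond t the two energy densities coincide; on [0, t] the Taylor remainder is bounded uniformly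
    in d. *)
Lemma variation_step : exists B, forall d, `|d| <= 1 ->
  (forall y, 0 <= y -> 0 <= f y + d * phi y) ->
  0 <= d * Rintegral mu `[0, t] dir + d ^+ 2 * B.
Proof.
have [M M0 bM] := bounds.
exists ((M ^+ 2 + 26 * M ^+ 5) * t) => d d1 hpos.
have ah := variation_admissible hpos.
have lf := admissible_energy_LI af; have lh := admissible_energy_LI ah.
set h := fun y => f y + d * phi y in ah lh *.
set gh := fun y => g y + d * psi y in ah lh *.
have := minf ah; rewrite /energy => mfh.
have le : Rintegral mu Rp (edens f g) <= Rintegral mu Rp (edens h gh).
  apply: fine_le => //.
  - exact: (@integrable_fin_num _ _ _ mu Rp _ _ lf).
  - exact: (@integrable_fin_num _ _ _ mu Rp _ _ lh).
have : 0 <= Rintegral mu Rp (fun y => edens h gh y - edens f g y).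
  by rewrite (RintegralB _ lh lf)// subr_ge0.
rewrite (Rint_half_line_split t0); last exact: LI_B.
rewrite (_ : Rintegral mu `]t, +oo[ _ = 0); last first.
  transitivity (Rintegral mu `]t, +oo[ (fun=> 0 : R)).
    apply: eq_Rintegral => y; rewrite inE/= in_itv/= andbT => /ltW ty.
    by rewrite /edens /h /gh phi_out// psi_out// !mulr0 !addr0 subrr.
  by rewrite Rintegral_cst// mul0r.
rewrite addr0 => le0; apply: le_trans le0 _.
have -> : d ^+ 2 * ((M ^+ 2 + 26 * M ^+ 5) * t) =
    Rintegral mu `[0, t] (fun=> d ^+ 2 * (M ^+ 2 + 26 * M ^+ 5)).
  rewrite Rintegral_cst//= lebesgue_measure_itv/= lte_fin.
  by rewrite (le_lt_trans s0 (lt_trans sm mt))/= oppr0 addr0 mulrA.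
have lB : LI `[0, t] (fun=> d ^+ 2 * (M ^+ 2 + 26 * M ^+ 5)).
  by apply: LI_cst => //; exact: itvcc_lty.
have lZ : LI `[0, t] (fun y => d * dir y) by exact: LI_Z.
rewrite -(RintegralZl d _ LI_dir)// -(RintegralD _ lZ lB)//.
apply: le_Rintegral => //.
- by apply: LI_B => //; exact: LI_subset_half_line.
- exact: LI_D.
- move=> y /=; rewrite in_itv/= => yt; have [fM pM qM] := bM y yt.
  apply: edens_variation => //; rewrite v_ge0/= v_le1//.
  by case/andP: yt.
Qed.

(** Integration by parts: the derivative of (c f + [ELprim]) times the tent has zero integral, as
    the tent vanishes at both ends. Subtracting it leaves g - c f - [ELprim], the density of
    [ELres], against [dtent]. *)
Lemma Rint_dir : Rintegral mu `[0, t] dir =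
  (ELres m - ELres s) / (m - s) - (ELres t - ELres m) / (t - m).
Proof.
rewrite -(Rint_mul_dtent prim_ELres)//.
have pZ : prim (fun y => c * f y + ELprim y)
    (fun y => c * g y + (f y ^+ 4 + gn y)).
  by apply: prim_D; [exact: prim_Z|exact: prim_ELprim].
have [lZ hZ] := prim_mul pZ (prim_tent s m t) t0.
move: hZ; rewrite tent_eq0// tent0// !mulr0 add0r => /esym hZ.
rewrite -[RHS]addr0 -[X in _ = _ + X]hZ -RintegralD//; last first.
  have [lL _] := prim_ELres t0.
  apply: (@LI_eq _ _ (fun y => dtent s m t y * (g y - c * f y - ELprim y))) => // [y _|].
    exact: mulrC.
  apply: (@LI_mul_bounded _ _ _ _ ((m - s)^-1 + (t - m)^-1)) => //.
  - exact: measurable_dtent.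
  - by move=> y _; exact: dtent_bound.
apply: eq_Rintegral => y _; rewrite /dir vpsi vphi -/chi -/theta; ring.
Qed.

(** Divide [variation_step] by d and let d tend to 0. The sign 1 is available from f >= 0 alone; the
    sign -1 requires f to stay away from 0 on the support of the tent. *)
Lemma tent_variation_ge0 sgn : `|sgn| <= 1 ->
  (exists2 e, 0 < e & forall d y, 0 <= d <= e -> 0 <= y ->
     0 <= f y + d * sgn * expR (c * y) * tent s m t y) ->
  0 <= sgn * ((ELres m - ELres s) / (m - s) - (ELres t - ELres m) / (t - m)).
Proof.
move=> s1 [e e0 he]; rewrite -Rint_dir.
have [B hB] := variation_step.
set I := Rintegral _ _ _ in hB *.
apply/ler_addgt0Pr => k k0.
pose B' := `|B| + 1.
have B0 : 0 < B' by rewrite ltr_wpDl.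
(* The first two entries keep the variation admissible and small; the last makes the quadratic term
   at most d k. *)
pose d := Num.min (Num.min e 1) (k / B').
have d0 : 0 < d by rewrite !lt_min e0 ltr01 divr_gt0.
have de : d <= e by rewrite !ge_min lexx.
have d1 : d <= 1 by rewrite !ge_min lexx orbT.
have dk : d * B' <= k by rewrite -ler_pdivlMr// ge_min lexx orbT.
have := hB (d * sgn) _ _; rewrite normrM (gtr0_norm d0).
have ds1 : d * `|sgn| <= 1 by rewrite -[leRHS]mulr1 ler_pM// ltW.
move=> /(_ ds1) h.
have {}h : 0 <= d * sgn * I + (d * sgn) ^+ 2 * B.
  apply: h => y y0; rewrite /phi !mulrA; apply: he => //.
  by rewrite (ltW d0).
have sq : (d * sgn) ^+ 2 * B <= d * k.
  rewrite (@le_trans _ _ (d ^+ 2 * B'))//; last by rewrite expr2 -mulrA ler_wpM2l// ltW.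
  rewrite exprMn -mulrA ler_wpM2l ?sqr_ge0//.
  rewrite (@le_trans _ _ `|sgn ^+ 2 * B|) ?ler_norm// normrM normrX.
  rewrite (@le_trans _ _ `|B|) ?lerDl//.
  by rewrite -[leRHS]mul1r ler_wpM2r// expr_le1.
rewrite -(pmulr_rge0 _ d0) mulrDr mulrA.
lra.
Qed.

End tent_variation.

End first_variation.

(** * First and last crossings of a level *)

Section level_crossings.
Context {R : realType}.
Implicit Types (F f : R -> R) (a b y z K : R).

Lemma prim_first_le F f K a b : prim F f -> 0 <= a -> a <= b ->
  K < F a -> F b <= K ->
  exists z, [/\ a < z <= b, F z <= K & forall y, a <= y < z -> K < F y].
Proof.
move=> pF a0 ab Fa Fb.
pose E := [set y | a <= y <= b /\ F y <= K].
have Eb : E b by split => //; rewrite ab lexx.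
have lbE : lbound E a by move=> y [/andP[]].
have hE : has_inf E by split; [exists b|exists a].
pose z := inf E.
have az : a <= z by apply: lb_le_inf => //; exists b.
have zb : z <= b by apply: ge_inf => //; exists a.
have Fz : F z <= K.
  rewrite leNgt; apply/negP => FzK.
  have gap : 0 < F z - K by rewrite subr_gt0.
  have [d d0 hd] := prim_cts pF (le_trans a0 az) gap.
  have [y [/andP[ay yb] Fy] yd] := inf_adherent d0 hE.
  have zy : z <= y by apply: ge_inf; [exists a|split; rewrite ?ay].
  have /ltr_normlP[] : `|F y - F z| < F z - K.
    apply: hd; [exact: le_trans ay|rewrite ger0_norm; lra].
  by lra.
exists z; split => //.
  by rewrite zb andbT lt_neqAle az andbT; apply: contraTneq Fa => ->; rewrite -leNgt.
move=> y /andP[ay yz]; rewrite ltNge; apply/negP => FyK.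
suff : z <= y by rewrite leNgt yz.
by apply: ge_inf; [exists a|split; rewrite ?ay ?(le_trans (ltW yz))].
Qed.

Lemma prim_last_le F f K a b : prim F f -> 0 <= a -> a <= b ->
  F a <= K -> K < F b ->
  exists z, [/\ a <= z < b, F z = K & forall y, z < y <= b -> K < F y].
Proof.
move=> pF a0 ab Fa Fb.
pose E := [set y | a <= y <= b /\ F y <= K].
have Ea : E a by split => //; rewrite ab lexx.
have ubE : ubound E b by move=> y [/andP[]].
have hE : has_sup E by split; [exists a|exists b].
pose z := sup E.
have az : a <= z by apply: ub_le_sup => //; exists b.
have zb : z <= b by apply: ge_sup => //; exists a.
have z0 := le_trans a0 az.
have Fz : F z <= K.
  rewrite leNgt; apply/negP => FzK.
  have gap : 0 < F z - K by rewrite subr_gt0.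
  have [d d0 hd] := prim_cts pF z0 gap.
  have [y [/andP[ay yb] Fy] yd] := sup_adherent d0 hE.
  have zy : y <= z by apply: ub_le_sup; [exists b|split; rewrite ?ay].
  have /ltr_normlP[] : `|F y - F z| < F z - K.
    apply: hd; [exact: le_trans ay|rewrite -/z in yd; rewrite ler0_norm; lra].
  by lra.
have zb' : z < b.
  by rewrite lt_neqAle zb andbT; apply: contraTneq Fb => <-; rewrite -leNgt.
have H y : z < y <= b -> K < F y.
  move=> /andP[zy yb]; rewrite ltNge; apply/negP => FyK.
  suff : y <= z by rewrite leNgt zy.
  by apply: ub_le_sup; [exists b|split; rewrite ?yb ?(le_trans az (ltW zy))].
exists z; split; rewrite ?az ?zb'//.
apply/eqP; rewrite eq_le Fz/= leNgt; apply/negP => FzK.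
have gap : 0 < K - F z by rewrite subr_gt0.
have [d d0 hd] := prim_cts pF z0 gap.
pose y := Num.min b (z + d / 2).
have zy : z < y by rewrite lt_min zb'/= ltrDl divr_gt0.
have yb : y <= b by rewrite ge_min lexx.
have yd : y <= z + d / 2 by rewrite ge_min lexx orbT.
have /ltr_normlP[] : `|F y - F z| < K - F z.
  apply: hd; [lra|rewrite gtr0_norm; lra].
have := H y; rewrite zy yb => /(_ isT); lra.
Qed.

Lemma prim_lin k : prim (fun y : R => k * y) (fun=> k).
Proof.
move=> y y0; split; first by apply: LI_cst => //; exact: itvcc_lty.
rewrite Rintegral_cst//= lebesgue_measure_itv/= lte_fin mulr0 add0r.
by case: ltP => [_|]; rewrite ?oppr0 ?addr0//= => y0'; congr (_ * _); lra.
Qed.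

End level_crossings.

(** * Minimizers: positivity, Euler-Lagrange equation, upper bound *)

Section euler_lagrange.
Context {R : realType}.
Notation mu := (@lebesgue_measure R).
Notation Rp := (`[0, +oo[%classic : set R).
Variables (c TM : R) (gn : R -> R).
Hypothesis c0 : 0 < c.
Hypothesis TM0 : 0 < TM.
Hypothesis mgn : measurable_fun setT gn.
Hypothesis gnA : forall y, - TM ^+ 4 <= gn y <= 0.
Variables (f g : R -> R).
Hypothesis af : admissible c TM f g.
Hypothesis minf : forall h gh, admissible c TM h gh ->
  (energy c gn f g <= energy c gn h gh)%E.

Let gnB y : `|gn y| <= TM ^+ 4.
Proof. by have := gnA y; rewrite ler_norml => /andP[-> h]; rewrite (le_trans h)// exprn_ge0// ltW. Qed.

Let pf : prim f g := admissible_prim af.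
Let f_ge0 y : 0 <= y -> 0 <= f y. Proof. by have [h _] := af; exact: h. Qed.
Let f0 : f 0 = TM. Proof. by have [_ []] := af. Qed.
Let L := ELres c gn f.
Let Q := ELprim gn f.
Let pQ : prim Q (fun x => f x ^+ 4 + gn x) := prim_ELprim mgn gnB af.
Let If y := Rintegral mu `[0, y] f.
Let IQ y := Rintegral mu `[0, y] Q.
Let pIf : prim If f.
Proof.
by apply: prim_eq (prim_int 0 (prim_LI_int pf)) _ _ => // y _; rewrite add0r.
Qed.
Let pIQ : prim IQ Q.
Proof.
by apply: prim_eq (prim_int 0 (prim_LI_int pQ)) _ _ => // y _; rewrite add0r.
Qed.
Let LE y : L y = f y - c * If y - IQ y. Proof. by []. Qed.

(** Adding a tent always respects f >= 0, while subtracting one does not until positivity is known;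
    hence an inequality only. *)
Lemma ELres_concave s m t : 0 <= s -> s < m -> m < t ->
  (L t - L m) / (t - m) <= (L m - L s) / (m - s).
Proof.
move=> s0 sm mt; rewrite -subr_ge0 -[leRHS]mul1r.
apply: (tent_variation_ge0 c0 mgn gnB af minf s0 sm mt); first by rewrite normr1.
exists 1 => // d y /andP[d0 _] y0; rewrite mulr1 addr_ge0 ?f_ge0//.
have /andP[x0 _] := tent_bound y sm mt.
by rewrite !mulr_ge0 ?expR_ge0.
Qed.

(* At a zero of f >= 0 the right difference quotients of f are nonnegative;
   concavity of L carries this bound over to the left of the zero. *)
Let touch y0 s : 0 <= s -> s < y0 -> f y0 = 0 ->
  f s <= (y0 - s) * Q y0 - (IQ y0 - IQ s).
Proof.
move=> s0 sy fy0; have y00 : 0 < y0 by lra.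
have slope : - Q y0 <= (L y0 - L s) / (y0 - s).
  apply/ler_addgt0Pr => k k0; pose e := k / (c + 1).
  have e0 : 0 < e by rewrite divr_gt0// addr_gt0.
  have [d1 d10 h1] := prim_cts pf (ltW y00) e0.
  have [d2 d20 h2] := prim_cts pQ (ltW y00) e0.
  pose d := Num.min d1 d2 / 2.
  have d0 : 0 < d by rewrite divr_gt0// lt_min d10.
  have dd1 : d < d1.
    by rewrite /d ltr_pdivrMr// (le_lt_trans (_ : _ <= d1)) ?ge_min ?lexx//; lra.
  have dd2 : d < d2.
    by rewrite /d ltr_pdivrMr// (le_lt_trans (_ : _ <= d2)) ?ge_min ?lexx ?orbT//; lra.
  have near x : y0 <= x <= y0 + d -> f x <= e /\ Q x <= Q y0 + e.
    move=> /andP[yx xd]; split.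
      have /ltr_normlP[] : `|f x - f y0| < e.
        by apply: h1; [lra|rewrite ger0_norm; lra].
      by rewrite fy0; lra.
    have /ltr_normlP[] : `|Q x - Q y0| < e.
      by apply: h2; [lra|rewrite ger0_norm; lra].
    by lra.
  have k1 : If (y0 + d) - If y0 <= e * (y0 + d) - e * y0.
    apply: (prim_le pIf (prim_lin e)); [lra|lra|by move=> x /near[]].
  have k2 : IQ (y0 + d) - IQ y0 <= (Q y0 + e) * (y0 + d) - (Q y0 + e) * y0.
    apply: (prim_le pIQ (prim_lin _)); [lra|lra|by move=> x /near[]].
  have := @ELres_concave s y0 (y0 + d) s0 sy; rewrite ltrDl d0 => /(_ isT) h.
  rewrite -lerBlDr; apply: le_trans h.
  have -> : y0 + d - y0 = d by ring.
  rewrite ler_pdivlMr// !LE fy0.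
  have ek : (c + 1) * e = k by rewrite /e mulrCA divff ?mulr1// gt_eqF// addr_gt0.
  have fd : 0 <= f (y0 + d) by apply: f_ge0; lra.
  rewrite -ek.
  have ck1 : c * (If (y0 + d) - If y0) <= c * (e * (y0 + d) - e * y0).
    by rewrite ler_wpM2l// ltW.
  by lra.
have : - Q y0 * (y0 - s) <= L y0 - L s by rewrite -ler_pdivlMr// subr_gt0.
rewrite !LE fy0.
have : If s <= If y0.
  apply: (prim_nondecreasing pIf); [lra|lra|move=> x xx; apply: f_ge0; lra].
move=> h; have : 0 <= c * (If y0 - If s) by rewrite mulr_ge0 ?subr_ge0// ltW.
by lra.
Qed.

(** Let y0 be the first zero and S the supremum of f on [y0 - h, y0]. As gn <= 0, Q increases there
    by at most S^4 h, so [touch] bounds f by S^4 h^2, which is at most S/2 for small h. Thus S = 0,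
    against f > 0 before y0. *)
Lemma minimizer_gt0 y : 0 <= y -> 0 < f y.
Proof.
move=> y_ge0; rewrite ltNge; apply/negP => fy.
have [|y0 [/andP[y00 y0y] fy0 fpos]] := prim_first_le pf (lexx 0) y_ge0 _ fy.
  by rewrite f0.
have {}fy0 : f y0 = 0 by apply/eqP; rewrite eq_le fy0 f_ge0// ltW.
have [M M0 fM] := prim_bounded pf (ltW y00).
(* The entries keep the interval in the half-line, discard one factor h, and give S^4 h <= M^3 h S
   <= S/2. *)
pose h := Num.min y0 (Num.min 1 ((2 * M ^+ 3)^-1)).
have M3 : 0 < M ^+ 3 by rewrite exprn_gt0.
have h0 : 0 < h by rewrite !lt_min y00 ltr01 invr_gt0 mulr_gt0.
have hy : h <= y0 by rewrite ge_min lexx.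
have h1 : h <= 1 by rewrite !ge_min lexx orbT.
have hM : h * M ^+ 3 <= 2^-1.
  rewrite -ler_pdivlMr// -invfM.
  by rewrite !ge_min lexx !orbT.
pose E := f @` `[y0 - h, y0].
have Eh : E (f (y0 - h)) by exists (y0 - h) => //=; rewrite in_itv/= lexx/=; lra.
have ubE : has_ubound E.
  exists M => _ [x /= + <-]; rewrite in_itv/= => /andP[x1 x2].
  by apply: le_trans (ler_norm _) (fM _ _); lra.
pose S := sup E.
have fS x : y0 - h <= x <= y0 -> f x <= S.
  by move=> xh; apply: ub_le_sup => //; exists x.
have S0 : 0 <= S.
  by apply: le_trans (fS y0 _); rewrite ?fy0//; lra.
have SM : S <= M.
  apply: ge_sup; first by exists (f (y0 - h)).
  move=> _ [x /= + <-]; rewrite in_itv/= => /andP[x1 x2].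
  by apply: le_trans (ler_norm _) (fM _ _); lra.
have S4 : S ^+ 4 <= M ^+ 3 * S.
  by rewrite exprSr ler_wpM2r// lerXn2r// nnegrE ltW.
have step x : y0 - h <= x <= y0 -> f x <= S / 2.
  move=> /andP[x1]; rewrite le_eqVlt => /predU1P[->|x2].
    by rewrite fy0 divr_ge0.
  have x0 : 0 <= x by lra.
  apply: le_trans (touch x0 x2 fy0) _.
  have kQ r : x <= r <= y0 -> Q y0 - S ^+ 4 * h <= Q r.
    move=> /andP[r1 r2].
    have : Q y0 - Q r <= S ^+ 4 * y0 - S ^+ 4 * r.
      apply: (prim_le pQ (prim_lin _)); [lra|lra|move=> w /andP[w1 w2]].
      have /andP[_ gw] := gnA w.
      have fw : 0 <= f w by apply: f_ge0; lra.
      have : f w ^+ 4 <= S ^+ 4 by rewrite lerXn2r ?nnegrE// fS//; lra.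
      by lra.
    have S40 : 0 <= S ^+ 4 by exact: exprn_ge0.
    have : S ^+ 4 * (y0 - r) <= S ^+ 4 * h by rewrite ler_wpM2l//; lra.
    by lra.
  have : (Q y0 - S ^+ 4 * h) * y0 - (Q y0 - S ^+ 4 * h) * x <= IQ y0 - IQ x.
    by apply: (prim_le (prim_lin _) pIQ); [lra|lra|move=> w /kQ].
  have : S ^+ 4 * h <= S / 2.
    apply: (@le_trans _ _ (M ^+ 3 * S * h)); first by rewrite ler_wpM2r// ltW.
    by rewrite mulrC mulrA [leRHS]mulrC ler_wpM2r.
  have S40 : 0 <= S ^+ 4 by exact: exprn_ge0.
  have : S ^+ 4 * h * (y0 - x) <= S ^+ 4 * h * 1.
    by rewrite ler_wpM2l ?mulr_ge0 ?(ltW h0)//; lra.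
  by lra.
have : S <= S / 2.
  apply: ge_sup; first by exists (f (y0 - h)).
  by move=> _ [x /= + <-]; rewrite in_itv/= => xh; apply: step.
have := fS (y0 - h); rewrite lexx gerBl (ltW h0) => /(_ isT).
have := fpos (y0 - h); rewrite subr_ge0 hy ltrBlDr ltrDl h0 => /(_ isT).
by lra.
Qed.

(** The minimum of f over [0, t] is positive, so tents may now be subtracted. The amplitude min f /
    e^(ct) is safe, since e^(cy) <= e^(ct) on the support. *)
Lemma ELres_slopes s m t : 0 <= s -> s < m -> m < t ->
  (L t - L m) / (t - m) = (L m - L s) / (m - s).
Proof.
move=> s0 sm mt; apply/eqP; rewrite eq_le ELres_concave//=.
rewrite -subr_ge0 -opprB -mulN1r.
apply: (tent_variation_ge0 c0 mgn gnB af minf s0 sm mt).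
  by rewrite normrN1.
have t0 : 0 <= t by lra.
have [z zt fz] := EVT_min t0 (prim_within_continuous pf t0).
have fz0 : 0 < f z by apply: minimizer_gt0; move: zt; rewrite in_itv/= => /andP[].
exists (f z / expR (c * t)); first by rewrite divr_gt0// expR_gt0.
move=> d y /andP[d0 de] y0.
have [yt|ty] := leP y t; last by rewrite tent_eq0 ?(ltW ty)// mulr0 addr0 f_ge0.
have fzy : f z <= f y by apply: fz; rewrite in_itv/= y0.
have /andP[x0 x1] := tent_bound y sm mt.
have : d * expR (c * t) <= f z by rewrite -ler_pdivlMr ?expR_gt0.
have : d * (expR (c * y) * tent s m t y) <= d * expR (c * t).
  rewrite ler_wpM2l// -[leRHS]mulr1 ler_pM ?expR_ge0//.
  by rewrite ler_expR ler_wpM2l// ltW.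
by lra.
Qed.

Lemma euler_lagrange : exists C, forall y, 0 <= y ->
  f y = TM + C * y + c * If y + IQ y.
Proof.
have L0 : L 0 = TM by rewrite LE f0 /If /IQ !Rint_pt mulr0 !subr0.
(* The slope of the affine function L is read off on [0, 1] and compared through the triples 0 < y <
   1 or 0 < 1 < y. *)
exists (L 1 - L 0) => y; rewrite le_eqVlt => /predU1P[<-|y0].
  by rewrite f0 /If /IQ !Rint_pt !mulr0 !addr0.
suff : L y - L 0 = (L 1 - L 0) * y by rewrite L0 LE; lra.
have [y1|y1|->] := ltgtP y 1; last by rewrite mulr1.
- have := ELres_slopes (lexx 0) y0 y1; rewrite subr0 => /eqP.
  have n1 : 1 - y != 0 by rewrite gt_eqF// subr_gt0.
  have n2 : y != 0 by rewrite gt_eqF.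
  rewrite eqr_div//.
  by move=> /eqP; move: (L 0) (L 1) (L y) => l0 l1 ly h; lra.
- have := ELres_slopes (lexx 0) ltr01 y1; rewrite subr0 divr1 => /eqP.
  rewrite eq_sym -subr_eq0 => /eqP h.
  have : (L y - L 1) / (y - 1) * (y - 1) = L y - L 1.
    by rewrite mulfVK// gt_eqF//; lra.
  have -> : (L y - L 1) / (y - 1) = L 1 - L 0 by lra.
  by lra.
Qed.

(** Here G is f' and p is e^(-cx) f'. Once p is positive above the level TM, f cannot return to it
    and dominates k e^(cx); then e^(-cx) f^2 >= k^2 contradicts membership in the weighted L^2
    space. *)
Lemma minimizer_le y : 0 <= y -> f y <= TM.
Proof.
move=> y_ge0; rewrite leNgt; apply/negP => fy.
have [C fE] := euler_lagrange.
pose G y := C + c * f y + Q y.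
have pG : prim f G.
  have pC := prim_D (prim_D (prim_lin C) (prim_Z c pIf)) pIQ.
  apply: prim_eq (prim_D (prim_cst TM) pC) _ _ => [x x0|x x0].
    by rewrite (fE _ x0); ring.
  by rewrite add0r.
pose q x := f x ^+ 4 + gn x.
have pG' : prim G (fun x => c * G x + q x).
  apply: prim_eq (prim_D (prim_D (prim_cst C) (prim_Z c pG)) pQ) _ _ => // x _.
  by rewrite add0r.
pose p x := expR (- c * x) * G x.
have pp : prim p (fun x => expR (- c * x) * q x).
  apply: prim_eq (prim_mul (prim_expR (- c)) pG') _ _ => // x _; ring.
have q0 x : TM <= f x -> 0 <= expR (- c * x) * q x.
  move=> fx; rewrite mulr_ge0 ?expR_ge0// /q.
  have /andP[gx _] := gnA x.
  have : TM ^+ 4 <= f x ^+ 4.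
    by rewrite lerXn2r// nnegrE ?(ltW TM0)// (le_trans (ltW TM0) fx).
  by lra.
have pE x : G x = expR (c * x) * p x.
  by rewrite /p mulrA -expRD mulNr addrN expR0 mul1r.
have [|z [/andP[z0 zy] fz fgt]] := prim_last_le pf (lexx 0) y_ge0 _ fy.
  by rewrite f0.
(* Otherwise, p being nondecreasing on [z, y], f' <= 0 there, against f z = TM < f y. *)
have p1 : 0 < p y.
  rewrite ltNge; apply/negP => py.
  have : f y - f z <= 0 * y - 0 * z.
    apply: (prim_le pG (prim_lin 0)) => //; first exact: ltW.
    move=> x /andP[zx xy]; rewrite pE.
    rewrite mulr_ge0_le0 ?expR_ge0//; apply: le_trans py.
    apply: (prim_nondecreasing pp) => //; first exact: le_trans zx.
    move=> w /andP[xw wy]; apply: q0.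
    have [<-|zw] := eqVneq z w; first by rewrite fz.
    by apply/ltW/fgt; rewrite wy andbT lt_neqAle zw/= (le_trans zx).
  by rewrite fz; lra.
have grow b : y <= b -> (forall x, y <= x <= b -> TM <= f x) ->
    forall x, y <= x <= b -> p y <= p x.
  move=> yb fx x /andP[yx xb]; apply: (prim_nondecreasing pp) => // w /andP[yw wx].
  by apply/q0/fx; rewrite yw (le_trans wx).
(* Up to a first return point z2, p stays above p y > 0, so f is nondecreasing and f z2 >= f y >
   TM. *)
have above x : y <= x -> TM < f x.
  move=> yx; rewrite ltNge; apply/negP => fx.
  have [z2 [/andP[yz2 z2x] fz2 fgt2]] := prim_first_le pf y_ge0 yx fy fx.
  have z20 : 0 <= z2 by lra.
  have fz2' : TM <= f z2.
    rewrite leNgt; apply/negP => fz2'.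
    have gap : 0 < TM - f z2 by rewrite subr_gt0.
    have [d d0 hd] := prim_cts pf z20 gap.
    pose w := Num.max y (z2 - d / 2).
    have w1 : y <= w by rewrite le_max lexx.
    have w2 : w < z2 by rewrite gt_max yz2/= ltrBlDr ltrDl divr_gt0.
    have w3 : z2 - d / 2 <= w by rewrite le_max lexx orbT.
    have /ltr_normlP[] : `|f w - f z2| < TM - f z2.
      by apply: hd; [lra|rewrite ltr0_norm; lra].
    by have := fgt2 w; rewrite w1 w2 => /(_ isT); lra.
  have ff w : y <= w <= z2 -> TM <= f w.
    move=> /andP[w1]; rewrite le_eqVlt => /predU1P[->//|w2].
    by apply/ltW/fgt2; rewrite w1.
  have := grow z2 (ltW yz2) ff => gp.
  suff : f y <= f z2 by lra.
  apply: (prim_nondecreasing pG) => //; first exact: ltW.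
  move=> w /gp pw; rewrite pE mulr_ge0 ?expR_ge0//; lra.
have pge x : y <= x -> p y <= p x.
  move=> yx; apply: (grow x yx); rewrite ?yx ?lexx// => w /andP[yw _].
  exact/ltW/above.
(* The first entry compares f with k e^(cx) at y, the second compares their derivatives beyond y. *)
pose k := Num.min (f y / expR (c * y)) (p y / c).
have fy0 : 0 < f y by exact: lt_trans TM0 fy.
have k0 : 0 < k by rewrite lt_min !divr_gt0// expR_gt0.
have kf : k * expR (c * y) <= f y.
  by rewrite -ler_pdivlMr ?expR_gt0// ge_min lexx.
have kp : k * c <= p y by rewrite -ler_pdivlMr// ge_min lexx orbT.
have fexp x : y <= x -> k * expR (c * x) <= f x.
  move=> yx.
  have : k * expR (c * x) - k * expR (c * y) <= f x - f y.
    apply: (prim_le (prim_Z k (prim_expR c)) pG) => // w /andP[yw wx].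
    rewrite pE mulrA [leRHS]mulrC ler_wpM2r ?expR_ge0//.
    exact: le_trans kp (pge _ yw).
  by lra.
have [_ [_ [_ [_ [_ [lf2 _]]]]]] := af.
have l2 : LI `[y, +oo[ (fun x => expR (- (c * x)) * f x ^+ 2).
  exact: LI_subset_half_line lf2.
have lk : LI `[y, +oo[ (fun=> k ^+ 2).
  apply: LI_le l2 => // x /=; rewrite in_itv/= andbT => yx.
  rewrite ger0_norm ?exprn_ge0 ?(ltW k0)//.
  rewrite (@le_trans _ _ (expR (- (c * x)) * (k * expR (c * x)) ^+ 2))//; last first.
    rewrite ler_wpM2l ?expR_ge0// lerXn2r ?nnegrE ?fexp//.
      by rewrite mulr_ge0 ?expR_ge0// ltW.
    by apply: f_ge0; lra.
  have -> : expR (- (c * x)) * (k * expR (c * x)) ^+ 2 = k ^+ 2 * expR (c * x).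
    by rewrite expRN; field; rewrite gt_eqF// expR_gt0.
  rewrite ler_peMr ?sqr_ge0// -expR0 ler_expR mulr_ge0 ?(ltW c0)//.
  exact: le_trans yx.
have := @integrable_lty _ _ _ mu `[y, +oo[%classic _ _ lk.
rewrite /= integral_cst//= lebesgue_measure_itv/= ltry.
rewrite [X in (_ * X < _)%E]/= mulry gtr0_sg ?exprn_gt0// mul1e.
by move=> /(_ (measurable_itv _)); rewrite ltxx.
Qed.

End euler_lagrange.

(** * Passage to the limit in the iteration *)

Section limit_equation.
Context {R : realType}.
Notation mu := (@lebesgue_measure R).
Notation Rp := (`[0, +oo[%classic : set R).

Lemma Rint_dominated_cvg (D : set R) (F : nat -> R -> R) (f g : R -> R) :
  measurable D -> (forall n, measurable_fun D (F n)) ->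
  (forall x, D x -> F n x @[n --> \oo] --> f x) ->
  (forall n x, D x -> `|F n x| <= g x) -> LI D g ->
  Rintegral mu D (F n) @[n --> \oo] --> Rintegral mu D f.
Proof.
move=> mD mF Ff Fg lg.
have mf : measurable_fun D f by exact: measurable_fun_cvg mF Ff.
have [|||||lf _ h] := @dominated_convergence _ _ _ mu D _
  (fun n x => (F n x)%:E) (fun x => (f x)%:E) (fun x => (g x)%:E) _ _ _ lg.
- by [].
- by move=> n; apply/measurable_EFinP; exact: mF.
- exact/measurable_EFinP.
- apply: aeW => x Dx; apply: cvg_EFin; last exact: Ff.
  exact: nearW.
- by apply: aeW => x n Dx; rewrite lee_fin; exact: Fg.
apply: fine_cvg; rewrite fineK//.
exact: integrable_fin_num.
Qed.

Lemma LI_bounded_half_line (f : R -> R) (B y : R) : measurable_fun Rp f ->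
  (forall x, 0 <= x -> `|f x| <= B) -> LI `[0, y] f.
Proof.
move=> mf fB; apply: (@LI_itv_bounded _ _ _ _ B); first exact: measurable_itvW.
by move=> x /andP[x0 _]; exact: fB.
Qed.

Lemma prim_int0 (f : R -> R) (B : R) : measurable_fun Rp f ->
  (forall x, 0 <= x -> `|f x| <= B) ->
  prim (fun y => Rintegral mu `[0, y] f) f.
Proof.
move=> mf fB.
apply: prim_eq (prim_int 0 (fun y _ => LI_bounded_half_line y mf fB)) _ _ => // y _.
by rewrite add0r.
Qed.

Variables (c TM : R) (fs : nat -> R -> R) (f : R -> R).
Hypotheses (TM0 : 0 < TM) (c0 : 0 < c).
Hypothesis it : iterates c TM fs.
Hypothesis fsf : forall y, 0 <= y -> fs n y @[n --> \oo] --> f y.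

(** The bounds propagate: 0 <= fs n <= TM and the mass bound on E place the source in [-TM^4, 0],
    exactly the range in which [minimizer_le] bounds the next iterate by TM. *)
Lemma iterate_bounds n :
  measurable_fun Rp (fs n) /\ forall y, 0 <= y -> 0 <= fs n y <= TM.
Proof.
have [f0 fS] := it; elim: n => [|n [mn bn]].
  have -> : fs 0%N = (fun=> 0) by apply/funext.
  by split => // y _; rewrite lexx ltW.
have [g [af minf]] := fS n.
have mg := measurable_gsrc mn.
have bg y := gsrc_bound y mn bn.
split; first exact: (prim_measurable (admissible_prim af)).
move=> y y0; rewrite (minimizer_le c0 TM0 mg bg af minf)// andbT.
by have [h _] := af; exact: h.
Qed.

Let msrc n : measurable_fun setT (gsrc (fs n)).
Proof. by have [mn _] := iterate_bounds n; exact: measurable_gsrc. Qed.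

Let bsrc n y : - TM ^+ 4 <= gsrc (fs n) y <= 0.
Proof. by have [mn bn] := iterate_bounds n; exact: gsrc_bound. Qed.

Lemma iterate_equation n : exists C, forall y, 0 <= y ->
  fs n.+1 y = TM + C * y + c * Rintegral mu `[0, y] (fs n.+1) +
    Rintegral mu `[0, y] (ELprim (gsrc (fs n)) (fs n.+1)).
Proof.
have [_ fS] := it; have [g [af minf]] := fS n.
exact: (euler_lagrange c0 TM0 (msrc n) (bsrc n) af minf).
Qed.

Lemma pow4_bound (x : R) : 0 <= x <= TM -> 0 <= x ^+ 4 <= TM ^+ 4.
Proof.
by move=> /andP[x0 xT]; rewrite exprn_ge0//= lerXn2r// nnegrE// ltW.
Qed.

Lemma limit_measurable : measurable_fun Rp f.
Proof.
apply: (@measurable_fun_cvg _ _ _ _ fs).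
  by move=> n; have [] := iterate_bounds n.
by move=> x /=; rewrite in_itv/= andbT; exact: fsf.
Qed.

Lemma limit_bounds y : 0 <= y -> 0 <= f y <= TM.
Proof.
move=> y0; have bn n : 0 <= fs n y <= TM by have [_ h] := iterate_bounds n; exact: h.
apply/andP; split.
  by apply: (cvgr_to_ge (fsf y0)); apply: nearW => n; case/andP: (bn n).
by apply: (cvgr_to_le (fsf y0)); apply: nearW => n; case/andP: (bn n).
Qed.

Lemma limit_at0 : f 0 = TM.
Proof.
have h := fsf (lexx 0); rewrite -cvg_shiftS in h.
have E : (fun n => fs n.+1 0) = (fun=> TM).
  apply/funext => n /=; have [_ fS] := it.
  by have [g [[_ [-> _]] _]] := fS n.
apply: (cvg_unique (@norm_hausdorff _ R) h).
by rewrite /= E; exact: cvg_cst.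
Qed.

Let fsS y : 0 <= y -> fs n.+1 y @[n --> \oo] --> f y.
Proof. by move=> y0; have := fsf y0; rewrite -cvg_shiftS. Qed.

Let cvg4 (a : nat -> R) (l : R) : a n @[n --> \oo] --> l ->
  a n ^+ 4 @[n --> \oo] --> l ^+ 4.
Proof.
move=> al; apply: (@cvg_comp _ _ _ a (fun x => x ^+ 4) _ _ _ al).
exact: exprn_continuous.
Qed.

Let mfs n : measurable_fun Rp (fs n).
Proof. by have [] := iterate_bounds n. Qed.

Let bfs n y : 0 <= y -> 0 <= fs n y <= TM.
Proof. by have [_ h] := iterate_bounds n; exact: h. Qed.

Let gsrc_cvg y : gsrc (fs n) y @[n --> \oo] --> gsrc f y.
Proof.
rewrite gsrcE; under eq_fun do rewrite gsrcE.
apply: cvgN; apply: (@Rint_dominated_cvg _ _ _ (fun x => TM ^+ 4 * Ekernel (x - y))) => //.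
- move=> n; apply: measurable_funM; first exact: measurable_Ekernel_sub.
  exact: measurable_funX.
- move=> x /=; rewrite in_itv/= andbT => x0.
  by apply: cvgM; [exact: cvg_cst|apply: cvg4; exact: fsf].
- move=> n x /=; rewrite in_itv/= andbT => x0.
  have /andP[h1 h2] := pow4_bound (bfs n x0).
  rewrite normrM (ger0_norm (Ekernel_ge0 _)) (ger0_norm h1) mulrC.
  by rewrite ler_wpM2r// Ekernel_ge0.
- by apply: LI_Z => //; exact: LI_Ekernel_sub.
Qed.

Lemma source_bound (h : R -> R) (y s : R) : 0 <= h y <= TM ->
  - TM ^+ 4 <= s <= 0 -> `|h y ^+ 4 + s| <= TM ^+ 4.
Proof.
move=> /pow4_bound/andP[h1 h2] /andP[s1 s2]; rewrite ler_norml.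
by apply/andP; split; lra.
Qed.

Let ELn n := ELprim (gsrc (fs n)) (fs n.+1).
Let EL := ELprim (gsrc f) f.

Let mELn n : measurable_fun Rp (fun x => fs n.+1 x ^+ 4 + gsrc (fs n) x).
Proof.
apply: measurable_funD; first exact: measurable_funX.
exact: measurable_funTS.
Qed.

Let ELn_src n x : 0 <= x -> `|fs n.+1 x ^+ 4 + gsrc (fs n) x| <= TM ^+ 4.
Proof. by move=> x0; apply: source_bound; [exact: bfs|exact: bsrc]. Qed.

Let pELn n : prim (ELn n) (fun x => fs n.+1 x ^+ 4 + gsrc (fs n) x).
Proof. exact: (prim_int0 (mELn n) (@ELn_src n)). Qed.

Let TM40 : 0 <= TM ^+ 4. Proof. by rewrite exprn_ge0// ltW. Qed.

Let ELn_bound n x : 0 <= x -> `|ELn n x| <= TM ^+ 4 * x.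
Proof.
move=> x0; rewrite -[X in _ * X]subr0; apply: Rint_bound => //.
  by have [] := pELn n x0.
by move=> w /andP[w0 _]; exact: ELn_src.
Qed.

Let ELn_cvg x : 0 <= x -> ELn n x @[n --> \oo] --> EL x.
Proof.
move=> x0; apply: (@Rint_dominated_cvg _ _ _ (fun=> TM ^+ 4)) => //.
- by move=> n; exact: measurable_itvW.
- move=> w /=; rewrite in_itv/= => /andP[w0 _].
  by apply: cvgD; [apply: cvg4; exact: fsS|exact: gsrc_cvg].
- by move=> n w /=; rewrite in_itv/= => /andP[w0 _]; exact: ELn_src.
- by apply: LI_cst => //; exact: itvcc_lty.
Qed.

Lemma limit_equation : exists C,
  prim f (fun y => C + c * f y + ELprim (gsrc f) f y).
Proof.
pose a y := c * Rintegral mu `[0, y] f + Rintegral mu `[0, y] EL.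
pose an n y := c * Rintegral mu `[0, y] (fs n.+1) + Rintegral mu `[0, y] (ELn n).
have ana y : 0 <= y -> an n y @[n --> \oo] --> a y.
  move=> y0; apply: cvgD.
    apply: cvgM; first exact: cvg_cst.
    apply: (@Rint_dominated_cvg _ _ _ (fun=> TM)) => //.
    - by move=> n; exact: measurable_itvW.
    - by move=> w /=; rewrite in_itv/= => /andP[w0 _]; exact: fsS.
    - move=> n w /=; rewrite in_itv/= => /andP[w0 _].
      by have /andP[h1 h2] := bfs n.+1 w0; rewrite ger0_norm.
    - by apply: LI_cst => //; exact: itvcc_lty.
  apply: (@Rint_dominated_cvg _ _ _ (fun=> TM ^+ 4 * y)) => //.
  - by move=> n; apply: measurable_itvW; exact: (prim_measurable (pELn n)).
  - by move=> w /=; rewrite in_itv/= => /andP[w0 _]; exact: ELn_cvg.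
  - move=> n w /=; rewrite in_itv/= => /andP[w0 wy].
    by apply: le_trans (ELn_bound n w0) _; rewrite ler_wpM2l.
  - by apply: LI_cst => //; exact: itvcc_lty.
(* Each iterate has its own integration constant, with no convergence known. Evaluating at y = 1
   expresses it through quantities that do converge. *)
pose C := f 1 - TM - a 1; exists C.
have fE y : 0 <= y -> f y = TM + C * y + a y.
  move=> y0; apply: (cvg_unique (@norm_hausdorff _ R) (fsS y0)) => /=.
  rewrite (_ : (fun n => fs n.+1 y) =
      (fun n => TM + (fs n.+1 1 - TM - an n 1) * y + an n y)); last first.
    apply/funext => n; have [Cn fn] := iterate_equation n.
    by rewrite (fn y y0) (fn 1 ler01) /an /ELn mulr1; ring.
  apply: cvgD; last exact: ana.
  apply: cvgD; first exact: cvg_cst.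
  apply: cvgM; last exact: cvg_cst.
  apply: cvgB; last exact: ana.
  by apply: cvgB; [exact: fsS|exact: cvg_cst].
have bf x : 0 <= x -> `|f x| <= TM.
  by move=> x0; have /andP[h1 h2] := limit_bounds x0; rewrite ger0_norm.
have pIf := prim_int0 limit_measurable bf.
have bg y := gsrc_bound y limit_measurable limit_bounds.
have pEL : prim EL (fun x => f x ^+ 4 + gsrc f x).
  apply: (@prim_int0 _ (TM ^+ 4)).
    apply: measurable_funD; first by apply: measurable_funX; exact: limit_measurable.
    by apply: measurable_funTS; apply: measurable_gsrc; exact: limit_measurable.
  by move=> x x0; apply: source_bound => //; exact: limit_bounds.
have pIEL : prim (fun y => Rintegral mu `[0, y] EL) EL.
  apply: prim_eq (prim_int 0 (prim_LI_int pEL)) _ _ => // y _.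
  by rewrite add0r.
have pa := prim_D (prim_cst TM) (prim_D (prim_lin C) (prim_D (prim_Z c pIf) pIEL)).
apply: (prim_eq pa) => y y0; first by rewrite (fE y y0) /a; ring.
by rewrite add0r addrA.
Qed.

End limit_equation.

(** * Oddness of S and decay of its primitive *)

Section second_primitive.
Context {R : realType}.
Notation mu := (@lebesgue_measure R).
Notation Rp := (`[0, +oo[%classic : set R).
Implicit Types (t x y z eta Y : R).

Lemma Rint_eq_except_pt (D : set R) (f g : R -> R) (a : R) : measurable D ->
  measurable_fun D f -> measurable_fun D g ->
  (forall x, D x -> x != a -> f x = g x) -> Rintegral mu D f = Rintegral mu D g.
Proof.
move=> mD mf mg fg; congr fine; apply: ae_eq_integral => //.
- exact/measurable_EFinP.
- exact/measurable_EFinP.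
- exists [set a]; split => //; first exact: lebesgue_measure_set1.
  by move=> x /=; apply: contra_notP => /eqP xa Dx; rewrite fg.
Qed.

(** At 0 the right limit 1/2 was chosen, so oddness fails there; the antisymmetry argument discards
    the diagonal as a null set. *)
Lemma SkerN z : z != 0 -> Sker (- z) = - Sker z.
Proof.
move=> z0; rewrite /Sker -mulrN; congr (_ * _).
rewrite -mulN1r -RintegralZl//; last exact: LI_kern_Sden.
apply: eq_Rintegral => t _; rewrite mulN1r -mulrN; congr (_ * _).
rewrite /Sden oppr_ge0 opprK; have [zn|zp|/eqP] := ltgtP z 0.
- by rewrite opprK.
- by [].
- by rewrite (negbTE z0).
Qed.

(** The ramp combination w is (t - |y - eta|)_+, and w w' is minus the integrand, so -w^2/2 is a
    primitive. *)
Lemma Rint_Sden t eta Y : 0 <= t -> 0 <= Y ->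
  Rintegral mu `[0, Y] (fun y => Sden t (y - eta)) =
  2^-1 * (Num.max 0 (t - `|eta|) ^+ 2 - Num.max 0 (t - `|Y - eta|) ^+ 2).
Proof.
move=> t0 Y0.
pose w y := Num.max 0 (y - (eta - t)) - 2 * Num.max 0 (y - eta) +
  Num.max 0 (y - (eta + t)).
pose w' y : R := \1_`[eta - t, +oo[ y - 2 * \1_`[eta, +oo[ y + \1_`[eta + t, +oo[ y.
have pw : prim w w'.
  apply: prim_D; last exact: prim_ramp.
  by apply: prim_B; [|apply: prim_Z]; exact: prim_ramp.
have wE y : w y = Num.max 0 (t - `|y - eta|).
  rewrite /w; have [h|h] := leP 0 (y - eta).
    rewrite (ger0_norm h).
    have [h1|h1] := leP 0 (y - (eta - t)); have [h2|h2] := leP 0 (y - (eta + t));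
      have [h3|h3] := leP 0 (t - (y - eta)); lra.
  rewrite (ltr0_norm h).
  have [h1|h1] := leP 0 (y - (eta - t)); have [h2|h2] := leP 0 (y - (eta + t));
    have [h3|h3] := leP 0 (t - - (y - eta)); lra.
have ww y : w y * w' y = - Sden t (y - eta).
  rewrite wE /w' !indic_ray /Sden; have [h|h] := leP 0 (y - eta).
    have -> : eta <= y by lra.
    have -> : eta - t <= y by lra.
    rewrite (ger0_norm h).
    by have [h1|h1] := leP (eta + t) y; have [h2|h2] := leP 0 (t - (y - eta)); lra.
  have -> : (eta <= y) = false by apply/negbTE; rewrite -ltNge; lra.
  have -> : (eta + t <= y) = false by apply/negbTE; rewrite -ltNge; lra.
  rewrite (ltr0_norm h) opprK.
  by have [h1|h1] := leP (eta - t) y; have [h2|h2] := leP 0 (t + (y - eta)); lra.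
have [l h] := prim_Z (- 2^-1) (prim_mul pw pw) Y0.
have -> : Rintegral mu `[0, Y] (fun y => Sden t (y - eta)) =
    Rintegral mu `[0, Y] (fun y => - 2^-1 * (w' y * w y + w y * w' y)).
  apply: eq_Rintegral => y _; have := ww y; lra.
have e0 : `|0 - eta| = `|eta| by rewrite sub0r normrN.
by move: h; rewrite !wE e0 !expr2; lra.
Qed.

(** In t^2 k(t) = t e^(-t) the factor t is absorbed through t/2 <= e^(t/2). This costs half of the
    decay, hence the rate 1/2 in the bounds on the primitive of S. *)
Lemma kern_sq_bound t z : 0 <= t ->
  0 <= kern t * Num.max 0 (t - `|z|) ^+ 2 <=
    if `|z| <= t then 2 * expR (- (2^-1 * t)) else 0.
Proof.
rewrite le_eqVlt => /predU1P[<-|t0].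
  rewrite /kern invr0 mulr0 mul0r lexx/=.
  by case: ifP => // _; rewrite mulr_ge0// expR_ge0.
rewrite mulr_ge0 ?kern_ge0 ?sqr_ge0 ?(ltW t0)//=.
case: ifPn => [zt|]; last first.
  by rewrite -ltNge => zt; rewrite (max_idPl _) ?expr2 ?mulr0//; lra.
have h1 : Num.max 0 (t - `|z|) ^+ 2 <= t * t.
  rewrite -expr2 lerXn2r ?nnegrE ?le_max ?lexx ?(ltW t0)//.
  by rewrite ge_max (ltW t0)/= gerBl.
apply: le_trans (ler_wpM2l (kern_ge0 (ltW t0)) h1) _.
rewrite mulrA kernMt//.
have -> : expR (- t) = expR (- (2^-1 * t)) * expR (- (2^-1 * t)).
  by rewrite -expRD; congr expR; lra.
rewrite -mulrA mulrC ler_wpM2r ?expR_ge0//.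
have h2 : 2^-1 * t <= expR (2^-1 * t).
  by apply: le_trans (expR_ge1Dx _); lra.
rewrite expRN ler_pdivrMl ?expR_gt0//; lra.
Qed.

Lemma Rint_kern_sq z :
  LI Rp (fun t => kern t * Num.max 0 (t - `|z|) ^+ 2) /\
  0 <= Rintegral mu Rp (fun t => kern t * Num.max 0 (t - `|z|) ^+ 2)
    <= 4 * expR (- (2^-1 * `|z|)).
Proof.
have h0 : 0 < 2^-1 :> R by rewrite invr_gt0.
have m1 : measurable_fun Rp (fun t => kern t * Num.max 0 (t - `|z|) ^+ 2).
  apply: measurable_funM; first exact: measurable_kern.
  apply: measurable_funX; apply: measurable_maxr => //.
  exact: measurable_funB.
have m2 : measurable_fun Rp
    (fun t : R => if `|z| <= t then 2 * expR (- (2^-1 * t)) else 0).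
  apply: measurable_funTS; apply: measurable_fun_ifT => //.
  - exact: measurable_fun_ler.
  - by apply: measurable_funM => //; exact: measurable_expRN.
have le2 : LI Rp (fun t : R => 2 * expR (- (2^-1 * t))).
  by apply: LI_Z => //; exact: LI_expRN.
have l2 : LI Rp (fun t : R => if `|z| <= t then 2 * expR (- (2^-1 * t)) else 0).
  apply: LI_le le2 => // t _; have := expR_ge0 (- (2^-1 * t)) => e0.
  by case: ifP => _; rewrite ?normr0 ?mulr_ge0// ger0_norm// mulr_ge0.
have l1 : LI Rp (fun t => kern t * Num.max 0 (t - `|z|) ^+ 2).
  apply: LI_le l2 => // t /=; rewrite in_itv/= andbT => t0.
  by have /andP[k1 k2] := kern_sq_bound z t0; rewrite ger0_norm.
split => //; apply/andP; split.
  apply: Rintegral_ge0 => t /=; rewrite in_itv/= andbT => t0.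
  by have /andP[] := kern_sq_bound z t0.
have -> : 4 * expR (- (2^-1 * `|z|)) = Rintegral mu Rp
    (fun t : R => if `|z| <= t then 2 * expR (- (2^-1 * t)) else 0).
  rewrite Rint_half_line_if// RintegralZl//; last exact: LI_expRN.
  by rewrite Rint_expRN// invrK; ring.
apply: le_Rintegral => // t /=; rewrite in_itv/= andbT => t0.
by have /andP[] := kern_sq_bound z t0.
Qed.

Lemma measurable_pair_Sker :
  measurable_fun setT (fun p : R * R => Sker (p.1 - p.2)).
Proof.
apply: (measurableT_comp measurable_Sker).
exact: measurable_funB.
Qed.

(* S is the derivative of minus the even function
   K(z) = 1/4 \int k(t) (t - |z|)_+^2 dt, which decays exponentially. *)
Lemma Rint_Sker_bound eta Y : 0 <= Y ->
  `|Rintegral mu `[0, Y] (fun y => Sker (y - eta))| <=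
  expR (- (2^-1 * `|eta|)) + expR (- (2^-1 * `|Y - eta|)).
Proof.
move=> Y0.
have [] := @Rintegral_fubini R `[0, Y] Rp (fun y t => kern t * Sden t (y - eta))
  (fun=> 1) (fun t => expR (- t)).
- by [].
- by [].
- have ms : measurable_fun setT (fun p : R * R => (p.1 - eta, p.2)).
    by apply: measurable_fun_pair => //; exact: measurable_funB.
  exact: (measurableT_comp measurable_pair_kern_Sden ms).
- by apply: LI_cst => //; exact: itvcc_lty.
- exact: LI_expRN1.
- move=> y t _ /=; rewrite in_itv/= andbT mul1r => t0.
  by apply: le_trans (kern_Sden_bound _ t0) _; case: ifP => // _; exact: expR_ge0.
move=> lS swap.
have mY : measurable (`[0, Y]%classic : set R) by exact: measurable_itv.
rewrite /Sker (@RintegralZl _ _ _ mu `[0, Y] _ _ mY lS) swap => {swap lS}.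
have [l1 /andP[b1 b1']] := Rint_kern_sq eta.
have [l2 /andP[b2 b2']] := Rint_kern_sq (Y - eta).
have -> : Rintegral mu Rp (fun t => Rintegral mu `[0, Y] (fun y => kern t * Sden t (y - eta))) =
    2^-1 * (Rintegral mu Rp (fun t => kern t * Num.max 0 (t - `|eta|) ^+ 2) -
      Rintegral mu Rp (fun t => kern t * Num.max 0 (t - `|Y - eta|) ^+ 2)).
  rewrite -(RintegralB _ l1 l2)// -RintegralZl//; last exact: LI_B.
  apply: eq_Rintegral => t; rewrite inE/= in_itv/= andbT => t0.
  rewrite RintegralZl//; first by rewrite Rint_Sden//; ring.
  apply: (@LI_itv_bounded _ _ _ _ t).
    apply: measurable_funTS.
    have ms : measurable_fun setT (fun y : R => (y - eta, t)).
      by apply: measurable_fun_pair => //; exact: measurable_funB.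
    exact: (measurableT_comp measurable_pair_Sden ms).
  move=> y _; rewrite norm_Sden// ge_max; apply/andP; split => //.
  by rewrite gerBl normr_ge0.
rewrite ler_norml; apply/andP; split; lra.
Qed.

End second_primitive.

(** * Convergence from a bounded dissipation integral *)

Section asymptotics.
Context {R : realType}.
Notation mu := (@lebesgue_measure R).
Notation Rp := (`[0, +oo[%classic : set R).

Lemma Rint_half_line_if_le (y : R) (h : R -> R) :
  Rintegral mu Rp (fun t => if t <= y then h t else 0) =
  Rintegral mu `[0, y] h.
Proof.
rewrite [LHS]Rintegral_mkcond [RHS]Rintegral_mkcond.
apply: eq_Rintegral => t _; rewrite !patchE !mem_setE !in_itv/= andbT.
by case: (t <= y); rewrite ?andbT ?andbF; case: ifP.
Qed.

(** A Barbalat argument: if f is e away from l at arbitrarily late times, the Lipschitz bound keeps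
    it e/2 away for a further time h, and each such visit adds at least d h to I, which never
    decreases and is bounded. *)
Lemma cvg_of_dissipation (f D I : R -> R) (l Lip B : R) : prim I D ->
  (forall y, 0 <= y -> 0 <= D y) -> (forall y, 0 <= y -> I y <= B) ->
  (forall x y, 0 <= x -> x <= y -> `|f y - f x| <= Lip * (y - x)) ->
  (forall e, 0 < e -> exists2 d, 0 < d &
     forall y, 0 <= y -> e <= `|f y - l| -> d <= D y) ->
  f y @[y --> +oo] --> l.
Proof.
move=> pI D0 IB fLip Dl.
apply/cvgrPdist_lt => e e0.
suff [Y hY] : exists Y, forall y, Y < y -> 0 <= y -> `|l - f y| < e.
  exists (Num.max Y 0); split; first by rewrite num_real.
  move=> y; rewrite gt_max => /andP[Yy y0]; exact: hY (ltW y0).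
apply: contrapT => /forallNP noY.
have far Y : exists2 y, Y <= y & 0 <= y /\ e <= `|f y - l|.
  have /existsNP[y /not_implyP[Yy /not_implyP[y0 /negP]]] := noY Y.
  by rewrite -leNgt distrC => fy; exists y; [exact: ltW|].
have e2 : 0 < e / 2 by rewrite divr_gt0.
have [d d0 hd] := Dl _ e2.
pose L := `|Lip| + 1.
have L0 : 0 < L by rewrite ltr_wpDl.
pose h := e / 2 / L.
have h0 : 0 < h by rewrite divr_gt0.
have LhE : L * h = e / 2 by rewrite /h mulrC mulfVK// gt_eqF.
have gain y : 0 <= y -> e <= `|f y - l| -> d * h <= I (y + h) - I y.
  move=> y0 fy.
  have -> : d * h = d * (y + h) - d * y by ring.
  apply: (prim_le (prim_lin d) pI) => //; first by rewrite lerDl ltW.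
  move=> x /andP[yx xh]; apply: hd; first exact: le_trans yx.
  have : `|f x - f y| <= e / 2.
    apply: le_trans (fLip y x y0 yx) _; rewrite -LhE.
    apply: (@le_trans _ _ (L * (x - y))).
      by rewrite ler_wpM2r ?subr_ge0// (le_trans (ler_norm _))// lerDl.
    by rewrite ler_wpM2l ?(ltW L0)//; lra.
  have := ler_normB (f x - l) (f x - f y).
  have -> : f x - l - (f x - f y) = f y - l by ring.
  by lra.
have many n : exists2 y, 0 <= y & I 0 + n%:R * (d * h) <= I y.
  elim: n => [|n [y y0 Iy]]; first by exists 0 => //; rewrite mul0r addr0.
  have [x yx [x0 fx]] := far y.
  exists (x + h); first by rewrite addr_ge0// ltW.
  have : I y <= I x.
    apply: (prim_nondecreasing pI) => // w /andP[yw _].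
    by apply: D0; exact: le_trans yw.
  have := gain x x0 fx.
  by rewrite -natr1 mulrDl mul1r; lra.
have dh0 : 0 < d * h by exact: mulr_gt0.
have [y y0] := many (Num.truncn (`|B - I 0| / (d * h))).+1.
have := IB y y0.
have : B - I 0 < (Num.truncn (`|B - I 0| / (d * h))).+1%:R * (d * h).
  rewrite -ltr_pdivrMr//.
  apply: le_lt_trans (truncnS_gt _).
  by rewrite ler_wpM2r ?ler_norm// invr_ge0 ltW.
by lra.
Qed.

(** * The first-order equation and the energy identity *)

Variables (c TM C : R) (f : R -> R).
Hypotheses (TM0 : 0 < TM) (c0 : 0 < c).
Hypothesis mf : measurable_fun Rp f.
Hypothesis bf : forall y, 0 <= y -> 0 <= f y <= TM.
Hypothesis f0 : f 0 = TM.
Hypothesis pf : prim f (fun y => C + c * f y + ELprim (gsrc f) f y).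

Let U := TM ^+ 4.
Let u x := (f \_ Rp) x ^+ 4.

Let U0 : 0 < U. Proof. exact: exprn_gt0. Qed.

Let mu_ : measurable_fun setT u.
Proof. by apply: measurable_funX; apply: (measurable_restrictT _ _).1. Qed.

Let uE x : 0 <= x -> u x = f x ^+ 4.
Proof. by move=> x0; rewrite /u patchE ifT// mem_setE in_itv/= x0. Qed.

Let bu x : 0 <= x -> 0 <= u x <= U.
Proof. by move=> x0; rewrite uE//; apply: pow4_bound => //; exact: bf. Qed.

Let nu x : 0 <= x -> `|u x| <= U.
Proof. by move=> /bu/andP[x0 xU]; rewrite ger0_norm. Qed.

Let Gconv y := Rintegral mu Rp (fun eta => Sker (y - eta) * u eta).

Let mSu y (D : set R) : measurable_fun D (fun eta => Sker (y - eta) * u eta).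
Proof.
apply: measurable_funTS; apply: measurable_funM => //.
apply: (measurableT_comp measurable_Sker); exact: measurable_funB.
Qed.

Let Su_bound y eta : 0 <= eta ->
  `|Sker (y - eta) * u eta| <= U / 2 * expR (- (1 * `|y - eta|)).
Proof.
move=> eta0; rewrite normrM mul1r.
have -> : U / 2 * expR (- `|y - eta|) = 2^-1 * expR (- `|y - eta|) * U by ring.
by apply: ler_pM => //; [exact: Sker_bound|exact: nu].
Qed.

Let LI_Su y : 0 <= y -> LI Rp (fun eta => Sker (y - eta) * u eta).
Proof.
move=> y0; apply: (@LI_le _ _ _ (fun eta => U / 2 * expR (- (1 * `|y - eta|)))) => //.
  by move=> x /=; rewrite in_itv/= andbT; exact: Su_bound.
by apply: LI_Z => //; exact: LI_expRN_dist.
Qed.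

Let Gconv_bound y : 0 <= y -> `|Gconv y| <= U.
Proof.
move=> y0; rewrite (le_trans (le_normr_Rintegral _ _))//; first exact: LI_Su.
have lE : LI Rp (fun eta => expR (- (1 * `|y - eta|))) by exact: LI_expRN_dist.
apply: (@le_trans _ _ (Rintegral mu Rp (fun eta => U / 2 * expR (- (1 * `|y - eta|))))).
  apply: le_Rintegral => //; first exact/LI_norm/LI_Su.
    exact: LI_Z.
  by move=> x /=; rewrite in_itv/= andbT; exact: Su_bound.
rewrite RintegralZl//.
have := @Rint_expRN_dist R 1 y ltr01 y0; rewrite divr1 => h.
have : U / 2 * Rintegral mu Rp (fun eta => expR (- (1 * `|y - eta|))) <= U / 2 * 2.
  by rewrite ler_wpM2l// divr_ge0// ltW.
by lra.
Qed.

Let mGconv : measurable_fun setT Gconv.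
Proof.
apply: (@measurable_Rintegral_param R Rp (fun y eta => Sker (y - eta) * u eta)) => //.
apply: measurable_funM; first exact: measurable_pair_Sker.
exact: (measurableT_comp mu_ measurable_snd).
Qed.

Let LI_u_cut y : LI Rp (fun eta => if eta <= y then u eta else 0).
Proof.
apply: (@LI_le _ _ _ (fun eta => U * expR y * expR (- eta))) => //.
- apply: measurable_funTS; apply: measurable_fun_ifT => //.
  exact: measurable_fun_ler.
- move=> x /=; rewrite in_itv/= andbT => x0; case: ifPn => [xy|_].
    apply: le_trans (nu x0) _; rewrite -mulrA -expRD ler_peMr ?(ltW U0)//.
    by rewrite -expR0 ler_expR subr_ge0.
  by rewrite normr0 !mulr_ge0 ?expR_ge0// ltW.
- by apply: LI_Z => //; exact: LI_expRN1.
Qed.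

Let LI_Su0 : LI Rp (fun eta => Sker eta * u eta).
Proof.
apply: (@LI_le _ _ _ (fun eta => U / 2 * expR (- (1 * `|0 - eta|)))) => //.
- by apply: measurable_funTS; apply: measurable_funM => //; exact: measurable_Sker.
- move=> x /=; rewrite in_itv/= andbT => x0; rewrite normrM mul1r sub0r normrN.
  have -> : U / 2 * expR (- `|x|) = 2^-1 * expR (- `|x|) * U by ring.
  by apply: ler_pM => //; [exact: Sker_bound|exact: nu].
- by apply: LI_Z => //; exact: LI_expRN_dist.
Qed.

Let K0 := Rintegral mu Rp (fun eta => Sker eta * u eta).

(** By [Rint_Ekernel], the integral of E * u over [0, y] contains the integral of u over [0, y],
    which cancels; the S-terms at the two ends remain. *)
Let ELprimE y : 0 <= y -> ELprim (gsrc f) f y = Gconv y + K0.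
Proof.
move=> y0.
have mu' : measurable_fun Rp u by exact: measurable_funTS.
pose cv s := Rintegral mu Rp (fun eta => Ekernel (eta - s) * u eta).
have lcv : LI `[0, y] cv.
  apply: (@LI_itv_bounded _ _ _ _ U).
    apply: measurable_funTS.
    apply: (@measurable_Rintegral_param R Rp (fun s eta => Ekernel (eta - s) * u eta)) => //.
    exact: (measurable_pair_conv mu_).
  by move=> s _; have /andP[h1 h2] := Rint_conv_bound s mu' bu; rewrite ger0_norm.
have lu : LI `[0, y] u.
  apply: (@LI_itv_bounded _ _ _ _ U); first exact: measurable_funTS.
  by move=> x /andP[x0 _]; exact: nu.
transitivity (Rintegral mu `[0, y] (fun s => u s - cv s)).
  apply: eq_Rintegral => s; rewrite inE/= in_itv/= => /andP[s0 _].
  rewrite uE// gsrcE; congr (_ - _); apply: eq_Rintegral => x.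
  by rewrite inE/= in_itv/= andbT => x0; rewrite uE.
rewrite (RintegralB _ lu lcv)// (Rint_conv_swap y0 mu_ bu).
transitivity (Rintegral mu Rp (fun eta => if eta <= y then u eta else 0) -
   Rintegral mu Rp (fun eta => (if eta <= y then u eta else 0) -
     (Sker (y - eta) * u eta + Sker eta * u eta))).
  rewrite Rint_half_line_if_le; congr (_ - _); apply: eq_Rintegral => eta _.
  by case: ifP => _; ring.
have lD := LI_D (measurable_itv _) (LI_Su y0) LI_Su0.
rewrite (RintegralB _ (LI_u_cut y) lD)// (RintegralD _ (LI_Su y0) LI_Su0)//.
by rewrite opprB addrC subrK.
Qed.

(** Chosen so that C + c f + K0 = c (f - a): both integration constants are absorbed. *)
Let a := - (C + K0) / c.

Let g y := c * (f y - a) + Gconv y.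

Let pfg : prim f g.
Proof.
apply: (prim_eq pf) => [//|y y0]; rewrite ELprimE// /g /a.
move: (Gconv y) K0 => G K.
by field; rewrite gt_eqF.
Qed.

Let LIb (h : R -> R) (B y : R) : measurable_fun Rp h ->
  (forall x, 0 <= x -> `|h x| <= B) -> LI `[0, y] h.
Proof. exact: LI_bounded_half_line. Qed.

Let mG : measurable_fun Rp Gconv. Proof. exact: measurable_funTS. Qed.
Let mu' : measurable_fun Rp u. Proof. exact: measurable_funTS. Qed.

(* Oddness of S kills the interaction of [0, Y] with itself. *)
Let antisym Y : 0 <= Y -> Rintegral mu `[0, Y]
  (fun y => Rintegral mu `[0, Y] (fun eta => u y * (Sker (y - eta) * u eta))) = 0.
Proof.
move=> Y0; pose P y eta := u y * (Sker (y - eta) * u eta).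
have mP : measurable_fun setT (fun p : R * R => P p.1 p.2).
  apply: measurable_funM; first exact: (measurableT_comp mu_ measurable_fst).
  apply: measurable_funM; first exact: measurable_pair_Sker.
  exact: (measurableT_comp mu_ measurable_snd).
have [] := @Rintegral_fubini R `[0, Y] `[0, Y] P (fun=> U * U) (fun=> 1) _ _ mP.
- by [].
- by [].
- by apply: LI_cst => //; exact: itvcc_lty.
- by apply: LI_cst => //; exact: itvcc_lty.
- move=> y eta /=; rewrite !in_itv/= => /andP[y0 _] /andP[eta0 _].
  rewrite mulr1 /P normrM ler_pM ?nu//.
  apply: le_trans (Su_bound y eta0) _.
  have : expR (- (1 * `|y - eta|)) <= 1.
    by rewrite mul1r -[leRHS]expR0 ler_expR oppr_le0.
  have := expR_ge0 (- (1 * `|y - eta|)) => e0 e1.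
  by have := U0; nra.
move=> lP swap.
have anti : Rintegral mu `[0, Y] (fun y => Rintegral mu `[0, Y] (P^~ y)) =
    - Rintegral mu `[0, Y] (fun y => Rintegral mu `[0, Y] (P y)).
  rewrite -mulN1r -(RintegralZl _ _ lP)//; apply: eq_Rintegral => y.
  rewrite inE/= in_itv/= => /andP[y0 yY].
  have mPy : measurable_fun setT (P y).
    exact: (measurableT_comp mP (measurable_pair1 y)).
  have lPy : LI `[0, Y] (P y).
    have lS : LI `[0, Y] (fun eta => Sker (y - eta) * u eta).
      by apply: LI_subset (LI_Su y0) => //; apply: subset_itvl.
    exact: (LI_Z (u y) (measurable_itv _) lS).
  rewrite -(RintegralZl _ _ lPy)//; apply: (@Rint_eq_except_pt _ _ _ _ y) => //.
  - apply: measurable_funTS; exact: (measurableT_comp mP (measurable_pair2 y)).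
  - by apply: measurable_funTS; exact: measurable_funM.
  - move=> eta _ ety; rewrite /P -(opprB y eta) SkerN; last by rewrite subr_eq0 eq_sym.
    by ring.
move: swap; rewrite anti => /eqP.
by rewrite -addr_eq0 -mulr2n mulrn_eq0/= => /eqP.
Qed.

(** What antisymmetry leaves of the integral of u (S * u) over [0, Y]: the action of ]Y, +oo[ on
    [0, Y]. *)
Let tail Y := Rintegral mu `[0, Y] (fun y =>
  u y * Rintegral mu `]Y, +oo[ (fun eta => Sker (y - eta) * u eta)).

Let tail_inner_bound Y W y : 0 <= y <= Y -> (forall x, Y < x -> u x <= W) ->
  `|Rintegral mu `]Y, +oo[ (fun eta => Sker (y - eta) * u eta)| <=
  W / 2 * expR (- Y) * expR (1 * y).
Proof.
move=> /andP[y0 yY] uW.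
have Y0 : 0 <= Y := le_trans y0 yY.
have sub : `]Y, +oo[ `<=` Rp.
  by apply: subset_itvr; rewrite bnd_simp.
have lS : LI `]Y, +oo[ (fun eta => Sker (y - eta) * u eta).
  exact: LI_subset (LI_Su y0).
rewrite (le_trans (le_normr_Rintegral _ _))//.
have lE : LI `[Y, +oo[ (fun eta => expR (- eta)) by exact: LI_expRN1.
have lE' : LI `]Y, +oo[ (fun eta => expR (- eta)).
  by apply: LI_subset lE => //; apply: subset_itvr; rewrite bnd_simp.
have -> : W / 2 * expR (- Y) * expR (1 * y) = Rintegral mu `]Y, +oo[
    (fun eta => W / 2 * expR y * expR (- eta)).
  rewrite RintegralZl// Rintegral_itv_obnd_cbnd// Rint_expRN1 mul1r; ring.
apply: le_Rintegral => //; first exact: LI_norm.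
  exact: LI_Z.
move=> x /=; rewrite in_itv/= andbT => Yx.
have x0 : 0 <= x by apply: le_trans (ltW Yx).
have /andP[ux0 _] := bu x0.
rewrite normrM (ger0_norm ux0).
have -> : W / 2 * expR y * expR (- x) = 2^-1 * (expR y * expR (- x)) * W by ring.
apply: ler_pM => //; last exact: uW.
apply: le_trans (Sker_bound _) _.
rewrite -expRD ltr0_norm ?opprK//; lra.
Qed.

Let mtail Y : measurable_fun setT (fun y =>
  u y * Rintegral mu `]Y, +oo[ (fun eta => Sker (y - eta) * u eta)).
Proof.
apply: measurable_funM => //.
apply: (@measurable_Rintegral_param R `]Y, +oo[ (fun y eta => Sker (y - eta) * u eta)) => //.
apply: measurable_funM; first exact: measurable_pair_Sker.
exact: (measurableT_comp mu_ measurable_snd).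
Qed.

Let LI_tail Y : 0 <= Y -> LI `[0, Y] (fun y =>
  u y * Rintegral mu `]Y, +oo[ (fun eta => Sker (y - eta) * u eta)).
Proof.
move=> Y0; apply: (@LI_itv_bounded _ _ _ _ (U * (U / 2 * expR (- Y) * expR (1 * Y)))).
  exact: measurable_funTS.
move=> y yY; have /andP[y0 yY'] := yY; rewrite normrM ler_pM ?nu//.
apply: (@le_trans _ _ (U / 2 * expR (- Y) * expR (1 * y))).
  apply: tail_inner_bound => // x Yx.
  have x0 : 0 <= x by apply: le_trans (ltW Yx).
  by have /andP[] := bu x0.
apply: ler_wpM2l; last by rewrite ler_expR !mul1r.
by rewrite mulr_ge0 ?expR_ge0// divr_ge0// ltW.
Qed.

(** The integral of e^(y - eta)/2 over 0 <= y <= Y < eta is at most 1/2. Taking W = U bounds the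
    tail uniformly in Y; a small W is what excludes a <= 0. *)
Let tail_bound Y W : 0 <= Y -> 0 <= W -> (forall x, Y < x -> u x <= W) ->
  `|tail Y| <= U * W / 2.
Proof.
move=> Y0 W0 uW.
have [lE EY] := @prim_expR R 1 Y Y0.
rewrite (le_trans (le_normr_Rintegral _ _))//; first exact: LI_tail.
pose k := U * (W / 2 * expR (- Y)).
apply: (@le_trans _ _ (Rintegral mu `[0, Y] (fun y => k * (1 * expR (1 * y))))).
  apply: le_Rintegral => //; first exact/LI_norm/LI_tail.
    exact: LI_Z.
  move=> y /=; rewrite in_itv/= => yY; have /andP[y0 _] := yY.
  rewrite normrM mul1r /k -mulrA ler_pM ?nu//.
  exact: tail_inner_bound.
rewrite RintegralZl//.
have -> : Rintegral mu `[0, Y] (fun y => 1 * expR (1 * y)) = expR Y - 1.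
  by move: EY; rewrite mul1r mulr0 expR0; lra.
have -> : k * (expR Y - 1) = U * W / 2 * (expR (- Y) * expR Y - expR (- Y)).
  by rewrite /k; ring.
have UW : 0 <= U * W / 2 by rewrite divr_ge0// mulr_ge0// ltW.
by rewrite -expRD addNr expR0 ler_piMr// gerBl expR_ge0.
Qed.

Let Rint_uG Y : 0 <= Y ->
  Rintegral mu `[0, Y] (fun y => u y * Gconv y) = tail Y.
Proof.
move=> Y0.
have lin y : 0 <= y -> LI `[0, Y] (fun eta => Sker (y - eta) * u eta).
  by move=> y0; apply: LI_subset (LI_Su y0) => //; apply: subset_itvl.
have l0 : LI `[0, Y] (fun y => Rintegral mu `[0, Y] (fun eta => u y * (Sker (y - eta) * u eta))).
  have lB : LI `[0, Y] (fun y => u y * Gconv y - u y *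
      Rintegral mu `]Y, +oo[ (fun eta => Sker (y - eta) * u eta)).
    apply: LI_B => //; last exact: LI_tail.
    apply: (@LIb _ (U * U)); first exact: measurable_funM.
    by move=> x x0; rewrite normrM ler_pM ?nu// Gconv_bound.
  apply: LI_eq lB => // y /=; rewrite in_itv/= => /andP[y0 _].
  rewrite RintegralZl//; last exact: lin.
  by rewrite /Gconv (Rint_half_line_split Y0 (LI_Su y0)); ring.
rewrite -[RHS]add0r -[X in _ = X + _](antisym Y0) -RintegralD//; last exact: LI_tail.
apply: eq_Rintegral => y; rewrite inE/= in_itv/= => /andP[y0 _].
rewrite RintegralZl//; last exact: lin.
by rewrite /Gconv (Rint_half_line_split Y0 (LI_Su y0)); ring.
Qed.

(** After the swap a source at eta is weighted by the integral of S over [0, Y], small away from 0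
    and Y by [Rint_Sker_bound]. Each of the two exponentials of rate 1/2 has integral at most 4. The
    majorant used for the swap may depend on Y. *)
Let Rint_G_bound Y : 0 <= Y -> `|Rintegral mu `[0, Y] Gconv| <= 8 * U.
Proof.
move=> Y0.
have [] := @Rintegral_fubini R `[0, Y] Rp (fun y eta => Sker (y - eta) * u eta)
  (fun y => U / 2 * expR (1 * y)) (fun eta => expR (- eta)).
- by [].
- by [].
- apply: measurable_funM; first exact: measurable_pair_Sker.
  exact: (measurableT_comp mu_ measurable_snd).
- apply: LI_Z => //; apply: (@LI_itv_bounded _ _ _ _ (expR (1 * Y))).
    exact: measurable_expRM.
  by move=> x /andP[_ xY]; rewrite ger0_norm ?expR_ge0// ler_expR !mul1r.
- exact: LI_expRN1.
- move=> y eta _ /=; rewrite in_itv/= andbT => eta0.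
  apply: le_trans (Su_bound y eta0) _.
  rewrite -[leRHS]mulrA -expRD; apply: ler_wpM2l; first by rewrite divr_ge0// ltW.
  by rewrite ler_expR !mul1r lerNl -normrN ler_norm.
move=> _ ->.
have half0 : 0 < 2^-1 :> R by rewrite invr_gt0.
have l1 := @LI_expRN_dist R 2^-1 0 half0 (lexx 0).
have l2 := @LI_expRN_dist R 2^-1 Y half0 Y0.
have b1 := @Rint_expRN_dist R 2^-1 0 half0 (lexx 0).
have b2 := @Rint_expRN_dist R 2^-1 Y half0 Y0.
have inner eta : Rintegral mu `[0, Y] (fun y => Sker (y - eta) * u eta) =
    u eta * Rintegral mu `[0, Y] (fun y => Sker (y - eta)).
  rewrite -RintegralZl//; first by apply: eq_Rintegral => y _; rewrite mulrC.
  apply: (@LI_itv_bounded _ _ _ _ 2^-1).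
    apply: measurable_funTS; apply: (measurableT_comp measurable_Sker).
    exact: measurable_funB.
  move=> y _; apply: le_trans (Sker_bound _) _.
  by rewrite ler_piMr ?invr_ge0// -expR0 ler_expR oppr_le0.
have lsum := LI_D (measurable_itv _) l1 l2.
have bnd eta : 0 <= eta ->
    `|Rintegral mu `[0, Y] (fun y => Sker (y - eta) * u eta)| <=
    U * (expR (- (2^-1 * `|0 - eta|)) + expR (- (2^-1 * `|Y - eta|))).
  move=> eta0; rewrite inner normrM ler_pM ?nu// sub0r normrN.
  exact: Rint_Sker_bound.
have lsw : LI Rp (fun eta => Rintegral mu `[0, Y] (fun y => Sker (y - eta) * u eta)).
  apply: (@LI_le _ _ _ (fun eta => U * (expR (- (2^-1 * `|0 - eta|)) +
      expR (- (2^-1 * `|Y - eta|))))) => //.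
  - apply: measurable_funTS.
    apply: (@measurable_Rintegral_param R `[0, Y] (fun eta y => Sker (y - eta) * u eta)) => //.
    apply: measurable_funM; last exact: (measurableT_comp mu_ measurable_fst).
    apply: (measurableT_comp measurable_Sker); exact: measurable_funB.
  - by move=> eta /=; rewrite in_itv/= andbT; exact: bnd.
  - exact: LI_Z.
rewrite (le_trans (le_normr_Rintegral _ _))//.
apply: (@le_trans _ _ (Rintegral mu Rp (fun eta =>
    U * (expR (- (2^-1 * `|0 - eta|)) + expR (- (2^-1 * `|Y - eta|)))))).
  apply: le_Rintegral => //; first exact: LI_norm.
    exact: LI_Z.
  by move=> eta /=; rewrite in_itv/= andbT; exact: bnd.
rewrite RintegralZl// (RintegralD _ l1 l2)// [leRHS]mulrC ler_wpM2l ?(ltW U0)//.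
by move: b1 b2; rewrite invrK; lra.
Qed.

Let pf5 : prim (fun y => f y ^+ 5) (fun y => 5 * (u y * g y)).
Proof.
have p2 := prim_mul pfg pfg; have p4 := prim_mul p2 p2; have p5 := prim_mul p4 pfg.
apply: (prim_eq p5) => y y0; first by ring.
by rewrite uE//; ring.
Qed.

Let LIfa Y : LI `[0, Y] (fun y => f y - a).
Proof.
apply: (@LIb _ (TM + `|a|)); first exact: measurable_funB.
move=> y y0; rewrite (le_trans (ler_normB _ _))// lerD2r.
by have /andP[h1 h2] := bf y0; rewrite ger0_norm.
Qed.

Let LIufa Y : LI `[0, Y] (fun y => u y * (f y - a)).
Proof.
apply: (@LIb _ (U * (TM + `|a|))).
  by apply: measurable_funM => //; exact: measurable_funB.
move=> y y0; rewrite normrM ler_pM ?nu// (le_trans (ler_normB _ _))// lerD2r.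
by have /andP[h1 h2] := bf y0; rewrite ger0_norm.
Qed.

Let LIG Y : LI `[0, Y] Gconv.
Proof. by apply: (@LIb _ U) => //; exact: Gconv_bound. Qed.

Let LIuG Y : LI `[0, Y] (fun y => u y * Gconv y).
Proof.
apply: (@LIb _ (U * U)); first exact: measurable_funM.
by move=> x x0; rewrite normrM ler_pM ?nu// Gconv_bound.
Qed.

(** Multiply f' = c (f - a) + S * u by u = f^4 and integrate: the left side becomes the derivative
    of f^5/5. *)
Let energy_identity Y : 0 <= Y ->
  c * Rintegral mu `[0, Y] (fun y => u y * (f y - a)) + tail Y =
  (f Y ^+ 5 - TM ^+ 5) / 5.
Proof.
move=> Y0; have [_ h] := pf5 Y0; rewrite f0 in h.
have E : Rintegral mu `[0, Y] (fun y => 5 * (u y * g y)) =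
    5 * (c * Rintegral mu `[0, Y] (fun y => u y * (f y - a)) + tail Y).
  have lc := LI_Z c (measurable_itv _) (LIufa Y).
  have lD := LI_D (measurable_itv _) lc (LIuG Y).
  rewrite -Rint_uG// -(RintegralZl c _ (LIufa Y))// -(RintegralD _ lc (LIuG Y))//.
  rewrite -(RintegralZl 5 _ lD)//.
  by apply: eq_Rintegral => y _; rewrite /g; ring.
by rewrite h E; field.
Qed.

Let mass_identity Y : 0 <= Y ->
  c * Rintegral mu `[0, Y] (fun y => f y - a) + Rintegral mu `[0, Y] Gconv =
  f Y - TM.
Proof.
move=> Y0; have [_ ->] := pfg Y0; rewrite f0.
have lc := LI_Z c (measurable_itv _) (LIfa Y).
rewrite -(RintegralZl c _ (LIfa Y))// -(RintegralD _ lc (LIG Y))//.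
by rewrite addrC addKr.
Qed.

(** * Dissipation, convergence and positivity of the limit *)

Let l := Num.max 0 a.
Let b := l ^+ 4.
(** If a >= 0, both factors have the sign of f - a; if a < 0, then b = 0 and both are
    nonnegative. *)
Let Dis y := (f y - a) * (u y - b).
Let IDis y := Rintegral mu `[0, y] (fun y => u y * (f y - a)) -
  b * Rintegral mu `[0, y] (fun y => f y - a).

Let pDis : prim IDis Dis.
Proof.
move=> y y0; split.
  apply: (@LI_eq _ _ (fun y => u y * (f y - a) - b * (f y - a))) => // [x _|].
    by rewrite /Dis; ring.
  by apply: LI_B => //; exact: LI_Z.
have lb := LI_Z b (measurable_itv _) (LIfa y).
rewrite /IDis !Rint_pt mulr0 subrr add0r -(RintegralZl b _ (LIfa y))//.
rewrite -(RintegralB _ (LIufa y) lb)//.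
by apply: eq_Rintegral => x _; rewrite /Dis; ring.
Qed.

Let l_ge0 : 0 <= l. Proof. by rewrite le_max lexx. Qed.

(** Replacing a by l only lowers the product, for when a <= 0 the second factor is f^4 >= 0. Then
    f^4 - l^4 is factored and its mixed terms are dropped. *)
Let Dis_lower y : 0 <= y -> (f y - l) ^+ 2 * (f y ^+ 3 + l ^+ 3) <= Dis y.
Proof.
move=> y0; rewrite /Dis uE// /b; have /andP[fy _] := bf y0.
have la : (f y - l) * (f y ^+ 4 - l ^+ 4) <= (f y - a) * (f y ^+ 4 - l ^+ 4).
  rewrite /l; have [a0|a0] := leP 0 a; first by [].
  rewrite expr0n/= !subr0 ler_wpM2r ?exprn_ge0//.
  by rewrite lerDl oppr_ge0 ltW.
apply: le_trans la.
have -> : (f y - l) * (f y ^+ 4 - l ^+ 4) = (f y - l) ^+ 2 *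
    (f y ^+ 3 + l ^+ 3 + (f y ^+ 2 * l + f y * l ^+ 2)) by ring.
by rewrite ler_wpM2l ?sqr_ge0// lerDl addr_ge0// mulr_ge0// exprn_ge0.
Qed.

Let Dis_ge0 y : 0 <= y -> 0 <= Dis y.
Proof.
move=> y0; apply: le_trans (Dis_lower y0); have /andP[fy _] := bf y0.
by rewrite mulr_ge0 ?sqr_ge0// addr_ge0// exprn_ge0.
Qed.

(* |f - l| <= f + l, and (f + l)^3 <= 4 (f^3 + l^3). *)
Let Dis_coercive e : 0 < e -> exists2 d, 0 < d &
  forall y, 0 <= y -> e <= `|f y - l| -> d <= Dis y.
Proof.
move=> e0; exists (e ^+ 2 * (e ^+ 3 / 4)); first by rewrite mulr_gt0 ?divr_gt0 ?exprn_gt0.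
move=> y y0 efl; apply: le_trans (Dis_lower y0); have /andP[fy _] := bf y0.
apply: ler_pM; rewrite ?divr_ge0 ?exprn_ge0 ?(ltW e0)//.
  by rewrite -(real_normK (num_real (f y - l))) lerXn2r ?nnegrE ?(ltW e0).
have s : e <= f y + l.
  apply: le_trans efl _; rewrite ler_norml; apply/andP; split; have := l_ge0; lra.
have : e ^+ 3 <= (f y + l) ^+ 3 by rewrite lerXn2r ?nnegrE ?(ltW e0) ?addr_ge0.
have : (f y + l) ^+ 3 <= 4 * (f y ^+ 3 + l ^+ 3).
  rewrite -subr_ge0.
  have -> : 4 * (f y ^+ 3 + l ^+ 3) - (f y + l) ^+ 3 = 3 * (f y + l) * (f y - l) ^+ 2 by ring.
  by rewrite mulr_ge0 ?sqr_ge0// mulr_ge0// addr_ge0.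
by rewrite ler_pdivrMr//; lra.
Qed.

Let Lip_f x y : 0 <= x -> x <= y ->
  `|f y - f x| <= (c * (TM + `|a|) + U) * (y - x).
Proof.
move=> x0 xy; rewrite (prim_sub pfg)//; apply: Rint_bound => //.
  exact: prim_LI pfg x0.
move=> w /andP[xw _]; have w0 := le_trans x0 xw.
rewrite (le_trans (ler_normD _ _))// lerD ?Gconv_bound//.
rewrite normrM (ger0_norm (ltW c0)) ler_wpM2l ?(ltW c0)//.
rewrite (le_trans (ler_normB _ _))// lerD2r.
by have /andP[h1 h2] := bf w0; rewrite ger0_norm.
Qed.

Let cvg_l : f y @[y --> +oo] --> l.
Proof.
(* The first two terms come from the energy identity, with the tail bounded using W = U; the last is
   b times the bound given by the mass identity. *)
pose B := (TM ^+ 5 / 5 + U * U / 2 + b * (TM + TM + 8 * U)) / c.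
apply: (cvg_of_dissipation (B := B) pDis Dis_ge0 _ Lip_f Dis_coercive).
move=> Y Y0; rewrite /B ler_pdivlMr//.
have h1 := energy_identity Y0; have h2 := mass_identity Y0.
have /andP[fY0 fYT] := bf Y0.
have tb : `|tail Y| <= U * U / 2.
  apply: tail_bound => //; first exact: ltW.
  move=> x Yx; have x0 : 0 <= x by apply: le_trans (ltW Yx).
  by have /andP[] := bu x0.
have gb := Rint_G_bound Y0.
have b0 : 0 <= b by exact: exprn_ge0.
have f5 : f Y ^+ 5 <= TM ^+ 5 by rewrite lerXn2r ?nnegrE ?(ltW TM0).
have T5 : 0 <= TM ^+ 5 by rewrite exprn_ge0 ?(ltW TM0).
have mb : - (c * Rintegral mu `[0, Y] (fun y => f y - a)) <= TM + TM + 8 * U.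
  move: gb; rewrite ler_norml => /andP[_]; have := TM0; lra.
have := ler_wpM2l b0 mb.
move: tb; rewrite ler_norml => /andP[tb _].
by rewrite /IDis; lra.
Qed.

(** The chain is S <= F - 5 T <= k + 5 k V / 2 < 5 k (1 + V) <= S, with S = TM^5, T the tail and k
    the smallness level. *)
Let energy_deficit (I T F k V S : R) : - (V * k / 2) <= T ->
  I + T = (F - S) / 5 -> 0 <= I -> F <= k -> 0 < k -> 0 < k * V ->
  k * (5 * (1 + V)) <= S -> False.
Proof. by lra. Qed.

Let a_gt0 : 0 < a.
Proof.
rewrite ltNge; apply/negP => a0.
have l0 : l = 0 by apply/max_idPl.
have b0 : b = 0 by rewrite /b l0 expr0n.
(* The entry 1 gives e^4 <= e and e^5 <= e; the other makes the tail and the boundary term too small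
   to balance TM^5 / 5. *)
pose e := Num.min 1 (TM ^+ 5 / (5 * (1 + U))).
have T5 : 0 < TM ^+ 5 by exact: exprn_gt0.
have U1 : 0 < 5 * (1 + U) by have := U0; lra.
have e0 : 0 < e by rewrite lt_min ltr01 divr_gt0.
have e1 : e <= 1 by rewrite ge_min lexx.
have eU : e * (5 * (1 + U)) <= TM ^+ 5 by rewrite -ler_pdivlMr// ge_min lexx orbT.
have := cvg_l; rewrite l0 => /cvgrPdist_lt /(_ e e0) [Y [_ hY]].
pose Z := Num.max Y 0 + 1.
have Z0 : 0 <= Z by rewrite addr_ge0// le_max lexx orbT.
have YZ : Y < Z.
  by apply: (@le_lt_trans _ _ (Num.max Y 0)); rewrite ?le_max ?lexx// ltrDl.
have fe x : Z <= x -> f x <= e.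
  move=> Zx; have := hY x (lt_le_trans YZ Zx); rewrite /= sub0r normrN => h.
  by apply: le_trans (ler_norm _) (ltW h).
have ue x : Z < x -> u x <= e.
  move=> Zx; have x0 : 0 <= x by apply: le_trans (ltW Zx).
  rewrite uE//; have /andP[fx0 _] := bf x0; have fx := fe x (ltW Zx).
  have : f x ^+ 4 <= e ^+ 4 by rewrite lerXn2r ?nnegrE ?(ltW e0).
  have : e ^+ 4 <= e by rewrite -[leRHS]expr1 ler_wiXn2l ?(ltW e0).
  by lra.
have tb := tail_bound Z0 (ltW e0) ue.
have h := energy_identity Z0.
have /andP[fZ0 _] := bf Z0; have fZ := fe Z (lexx _).
have f5 : f Z ^+ 5 <= e.
  have : f Z ^+ 5 <= e ^+ 5 by rewrite lerXn2r ?nnegrE ?(ltW e0).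
  have : e ^+ 5 <= e by rewrite -[leRHS]expr1 ler_wiXn2l ?(ltW e0).
  by lra.
have pos : 0 <= c * Rintegral mu `[0, Z] (fun y => u y * (f y - a)).
  rewrite mulr_ge0 ?(ltW c0)// Rintegral_ge0// => x /=.
  rewrite in_itv/= => /andP[x0 _]; have := Dis_ge0 x0.
  by rewrite /Dis b0 subr0 mulrC.
move: tb; rewrite ler_norml => /andP[tb _].
have eU0 : 0 < e * U by exact: mulr_gt0.
exact: (energy_deficit tb h pos f5 e0 eU0 eU).
Qed.

Lemma limit_at_infinity : exists finf : R, f y @[y --> +oo] --> finf /\ 0 < finf.
Proof.
exists l; split; first exact: cvg_l.
by apply: lt_le_trans a_gt0 _; rewrite le_max lexx orbT.
Qed.

End asymptotics.

Theorem theorem3p8 (R : realType) (TM c : R) (fs : nat -> R -> R) (f : R -> R) :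
  0 < TM -> 0 < c ->
  iterates c TM fs ->
  (forall y, 0 <= y -> fs n y @[n --> \oo] --> f y) ->
  exists finf : R, f y @[y --> +oo] --> finf /\ 0 < finf.
Proof.
move=> TM0 c0 it fsf.
have [C pf] := limit_equation TM0 c0 it fsf.
apply: (limit_at_infinity TM0 c0 _ _ _ pf).
- exact: limit_measurable TM0 c0 it fsf.
- exact: limit_bounds TM0 c0 it fsf.
- exact: limit_at0 it fsf.
Qed.
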